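(* Let $\delta\ge0$ and let $\mathcal{L}=\mathcal{O}(-d_1,-d_2)$ with $d_1,d_2\in\mathbb{Z}$. Then any foliation $\mathcal{F}$ in $\mathrm{Fol}(\mathcal{L},S_\delta)$ is uniquely determined (up to multiplication by a nonzero scalar) by a differential $1$-form $$\Omega=A_0\,dX_0+A_1\,dX_1+B_0\,dY_0+B_1\,dY_1,$$ where $A_0,A_1\in H^0(S_\delta,\mathcal{O}(d_1-\delta+1,d_2+2))$, $B_0\in H^0(S_\delta,\mathcal{O}(d_1-\delta+2,d_2+1))$ and $B_1\in H^0(S_\delta,\mathcal{O}(d_1+2,d_2+1))$ are bi-homogeneous polynomials (not all of them equal to $0$) that satisfy the two conditions $$X_0A_0+X_1A_1-\delta Y_1B_1=0\qquad\text{and}\qquad Y_0B_0+Y_1B_1=0.$$ Moreover, if $i,j\in\{0,1\}$, a differential $1$-form defining $\mathcal{F}$ in the affine open set $U_{ij}$ is given by $\Omega_{ij}=\tilde{A}_{i'}^{ij}\,dx_{ij}+\tilde{B}_{j'}^{ij}\,dy_{ij}$, where $\{i'\}=\{0,1\}\setminus\{i\}$, $\{j'\}=\{0,1\}\setminus\{j\}$ and $H\mapsto\tilde{H}^{ij}$ denotes dehomogenization on $U_{ij}$.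
   Context: Everything is over $\mathbb{C}$. For an integer $\delta\ge 0$, the Hirzebruch surface $S_\delta=\mathbb{P}(\mathcal{O}_{\mathbb{P}^1}\oplus\mathcal{O}_{\mathbb{P}^1}(-\delta))$ is the quotient $\pi:(\mathbb{C}^2\setminus\{0\})\times(\mathbb{C}^2\setminus\{0\})\to S_\delta$ by the action of $(\mathbb{C}^* )^2$ given by $(\lambda,\mu)\cdot(X_0,X_1,Y_0,Y_1)=(\lambda X_0,\lambda X_1,\mu Y_0,\lambda^{-\delta}\mu Y_1)$. Its divisor class group is free on $F,M$ with $F^2=0$, $M^2=\delta$, $F\cdot M=1$ ($F$ is the class of $\{X_0=0\}$, $M$ the class of $\{Y_0=0\}$); $\mathcal{O}(d_1,d_2)$ is the invertible sheaf of class $d_1F+d_2M$. Its global sections are the bi-homogeneous polynomials of bi-degree $(d_1,d_2)$: those all of whose monomials $X_0^\alpha X_1^\beta Y_0^\gamma Y_1^\mu$ satisfy $\alpha+\beta-\delta\mu=d_1$ and $\gamma+\mu=d_2$. The affine open sets are $U_{ij}=\{\pi(X_0,X_1,Y_0,Y_1): X_i\ne0,\,Y_j\ne0\}\cong\mathbb{C}^2$, $i,j\in\{0,1\}$, with coordinates $(x_{00},y_{00})=(X_1/X_0,\,X_0^\delta Y_1/Y_0)$, $(x_{10},y_{10})=(X_0/X_1,\,X_1^\delta Y_1/Y_0)$, $(x_{01},y_{01})=(X_1/X_0,\,Y_0/(X_0^\delta Y_1))$, $(x_{11},y_{11})=(X_0/X_1,\,Y_0/(X_1^\delta Y_1))$.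 For a bi-homogeneous polynomial $H$, set $\tilde H^{00}=H(1,x_{00},1,y_{00})$, $\tilde H^{10}=H(x_{10},1,1,y_{10})$, $\tilde H^{01}=H(1,x_{01},y_{01},1)$, $\tilde H^{11}=H(x_{11},1,y_{11},1)$. $\Theta_{S_\delta}$ is the tangent sheaf. A foliation with tangent sheaf $\mathcal{L}$ is a class $[s]$, up to nonzero scalars, of a nonzero section $s\in H^0(S_\delta,\Theta_{S_\delta}\otimes\mathcal{L}^* )$; the space of these is $\mathrm{Fol}(\mathcal{L},S_\delta)=\mathbb{P}H^0(S_\delta,\Theta_{S_\delta}\otimes\mathcal{L}^* )$. Contraction with $2$-forms gives $\Theta_{S_\delta}\otimes\mathcal{L}^*\cong\Omega^1_{S_\delta}(d_1+2-\delta,d_2+2)$; under it $s$ corresponds to its annihilator, given locally by the contraction $\iota_{X_i}\omega_i$ of a local vector field $X_i$ defining $s$ with a local nowhere vanishing $2$-form $\omega_i$. A $1$-form defines $\mathcal{F}$ on an open set if it is a local expression of this annihilator. The form $\Omega$ determines $\mathcal{F}$ in the sense that it is the pullback by $\pi$ of this twisted $1$-form. *)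

(* Defs.v *)
From HB Require Import structures.
From mathcomp Require Import all_boot all_order all_algebra.
From mathcomp Require Import generic_quotient mpoly ring.

Set Implicit Arguments.
Unset Strict Implicit.
Unset Printing Implicit Defensive.

Import GRing.Theory.
Local Open Scope quotient_scope.

Local Open Scope ring_scope.

(* Vector fields and 1-forms on affine n-space are row vectors of coefficients
   in the bases d/dx_k and dx_k.  Identities between regular objects on dense
   open subsets of affine space are stated in its function field. *)

Notation ratfun C n := {fraction {mpoly C[n]}}.

Notation "p %:F" := (@FracField.tofrac _ p) : ring_scope.

Definition gen (C : fieldType) (n : nat) (k : 'I_n) : ratfun C n := ('X_k)%:F.

(* Partial derivative of a rational function, by the quotient rule; the choice
   of numerator and denominator is irrelevant by [ratderiv_div]. *)
Definition ratderiv (C : fieldType) (n : nat) (k : 'I_n) (f : ratfun C n) :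
    ratfun C n :=
  let p := \n_(repr f) in let q := \d_(repr f) in
  (mderiv k p * q - p * mderiv k q)%:F / (q ^+ 2)%:F.

Lemma quotient_rule_eq (R : comNzRingType) (a b p q a' b' p' q' : R) :
  a * q = p * b -> a' * q + a * q' = p' * b + p * b' ->
  (a' * b - a * b') * q ^+ 2 = (p' * q - p * q') * b ^+ 2.
Proof.
move=> e de; have h : a' * q = p' * b + p * b' - a * q' by rewrite -de addrK.
transitivity ((a' * q) * (q * b) - (a * q) * (b' * q)); first by ring.
rewrite h e.
transitivity (p' * q * b ^+ 2 - (a * q) * (q' * b)); first by ring.
by rewrite e; ring.
Qed.

Lemma ratderiv_div (C : fieldType) (n : nat) (k : 'I_n) (p q : {mpoly C[n]}) :
  q != 0 ->
  ratderiv k (p%:F / q%:F) =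
    (mderiv k p * q - p * mderiv k q)%:F / (q ^+ 2)%:F.
Proof.
move=> q0; rewrite /ratderiv; set f := p%:F / q%:F.
set a := \n_(repr f); set b := \d_(repr f).
have b0 : b != 0 by exact: denom_ratioP.
have ef : f = a%:F / b%:F.
  have -> : f = \pi_(ratfun C n) (repr f) by rewrite reprK.
  have bF : b%:F != 0 by rewrite tofrac_eq0.
  apply: (mulIf bF); rewrite mulfVK // -[repr f in LHS]Ratio_numden -/a -/b.
  rewrite !piE /FracField.mulf !numden_Ratio ?oner_eq0 //.
  apply/eqmodP; rewrite /= FracField.equivfE !numden_Ratio ?mulr1 ?oner_eq0 //.
  by rewrite mulrC.
have e : a * q = p * b.
  apply/eqP; rewrite -tofrac_eq !tofracM; apply/eqP.
  have qF : q%:F != 0 by rewrite tofrac_eq0.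
  have bF : b%:F != 0 by rewrite tofrac_eq0.
  have h := eqr_div a%:F p%:F bF qF.
  by rewrite -/f -ef eqxx in h; apply/eqP; rewrite -h.
have de : mderiv k a * q + a * mderiv k q = mderiv k p * b + p * mderiv k b.
  by rewrite -!mderivM e.
apply/eqP; rewrite eqr_div ?tofrac_eq0 ?expf_neq0 // -!tofracM tofrac_eq.
by apply/eqP; apply: quotient_rule_eq.
Qed.

(* p(z_1, ..., z_n) for rational functions z_k in m variables. *)
Definition ratsubst (C : fieldType) (n m : nat) (z : 'I_n -> ratfun C m)
    (p : {mpoly C[n]}) : ratfun C m :=
  mmap (fun c => (c%:MP)%:F) z p.

(* Pullback of a 1-form along the rational map z from m-space to n-space. *)
Definition pullback (C : fieldType) (n m : nat) (z : 'I_n -> ratfun C m)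
    (eta : 'rV[{mpoly C[n]}]_n) : 'rV[ratfun C m]_m :=
  \row_l \sum_k ratsubst z (eta 0 k) * ratderiv l (z k).

(* Derivative of the rational function f along the vector field v. *)
Definition lie (C : fieldType) (n : nat) (v : 'rV[{mpoly C[n]}]_n)
    (f : ratfun C n) : ratfun C n :=
  \sum_l (v 0 l)%:F * ratderiv l f.

(* Contraction of w dx /\ dy with v = v_0 d/dx + v_1 d/dy. *)
Definition contract (C : fieldType) (w : {mpoly C[2]})
    (v : 'rV[{mpoly C[2]}]_2) : 'rV[{mpoly C[2]}]_2 :=
  \row_k (if k == 0 then - (w * v 0 1) else w * v 0 0).

Definition nowhere_zero (C : fieldType) (n : nat) (f : {mpoly C[n]}) : Prop :=
  forall z : 'I_n -> C, f.@[z] != 0.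

(* A point (X_0, X_1, Y_0, Y_1), with coordinates in any field L containing the
   base field, is a map v : 'I_(2 + 2) -> L.  Taking for L a field of rational
   functions and for v its generators gives the formulas below as rational
   functions. *)
Definition hX (L : Type) (v : 'I_(2 + 2) -> L) (i : 'I_2) : L := v (lshift 2 i).
Definition hY (L : Type) (v : 'I_(2 + 2) -> L) (j : 'I_2) : L := v (rshift 2 j).

Definition other (i : 'I_2) : 'I_2 := rev_ord i.

(* The pair (i, j) stands for the affine open set U_ij. *)
Definition chart : Type := ('I_2 * 'I_2)%type.

Definition torus_act (L : fieldType) (delta : nat) (lam mu : L)
    (v : 'I_(2 + 2) -> L) : 'I_(2 + 2) -> L :=
  fun k => match split k with
           | inl i => lam * hX v i
           | inr j => if j == 0 then mu * hY v 0
                      else lam ^- delta * mu * hY v 1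
           end.

(* The coordinates (x_ij, y_ij) of the chart. *)
Definition coord (L : fieldType) (delta : nat) (p : chart)
    (v : 'I_(2 + 2) -> L) : 'I_2 -> L :=
  let: (i, j) := p in
  fun k => if k == 0 then hX v (other i) / hX v i
           else if j == 0 then hX v i ^+ delta * hY v 1 / hY v 0
           else hY v 0 / (hX v i ^+ delta * hY v 1).

(* The section of the quotient map over U_ij given by X_i = Y_j = 1. *)
Definition sect (L : nzRingType) (p : chart) (z : 'I_2 -> L) :
    'I_(2 + 2) -> L :=
  fun k => match split k with
           | inl i => if i == p.1 then 1 else z 0
           | inr j => if j == p.2 then 1 else z 1
           end.

(* The monomial of bi-degree (d1, d2) in X_i and Y_j: it is invertible on U_ij
   and so generates O(d1, d2) there. *)
Definition frame (L : fieldType) (delta : nat) (d1 d2 : int) (p : chart)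
    (v : 'I_(2 + 2) -> L) : L :=
  let: (i, j) := p in
  if j == 0 then hX v i ^ d1 * hY v 0 ^ d2
  else hX v i ^ (d1 + delta%:Z * d2) * hY v 1 ^ d2.

(* These facts tie the charts and frames to the quotient by the torus. *)
Lemma coord_torus_act (L : fieldType) (delta : nat) (p : chart) (lam mu : L)
    (v : 'I_(2 + 2) -> L) :
  lam != 0 -> mu != 0 ->
  coord delta p (torus_act delta lam mu v) =1 coord delta p v.
Proof.
move=> l0 m0 k; case: p => i j /=.
have hXa i' : hX (torus_act delta lam mu v) i' = lam * hX v i'.
  by rewrite /hX /torus_act (unsplitK (inl _)).
have hY0 : hY (torus_act delta lam mu v) 0 = mu * hY v 0.
  by rewrite /hY /torus_act (unsplitK (inr _)).
have hY1 : hY (torus_act delta lam mu v) 1 = lam ^- delta * mu * hY v 1.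
  by rewrite /hY /torus_act (unsplitK (inr _)).
rewrite !hXa !hY0 !hY1 exprMn.
have ld0 : lam ^+ delta != 0 by rewrite expf_neq0.
have -> : lam ^+ delta * hX v i ^+ delta * (lam ^- delta * mu * hY v 1) =
          mu * (hX v i ^+ delta * hY v 1).
  by rewrite mulrACA mulVKf.
by do 2?case: ifP => _; rewrite -mulf_div divff ?mul1r.
Qed.

Lemma frame_torus_act (L : fieldType) (delta : nat) (d1 d2 : int) (p : chart)
    (lam mu : L) (v : 'I_(2 + 2) -> L) :
  lam != 0 -> mu != 0 ->
  frame delta d1 d2 p (torus_act delta lam mu v) =
    lam ^ d1 * mu ^ d2 * frame delta d1 d2 p v.
Proof.
move=> l0 m0; case: p => i j /=.
have hXa i' : hX (torus_act delta lam mu v) i' = lam * hX v i'.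
  by rewrite /hX /torus_act (unsplitK (inl _)).
have hY0 : hY (torus_act delta lam mu v) 0 = mu * hY v 0.
  by rewrite /hY /torus_act (unsplitK (inr _)).
have hY1 : hY (torus_act delta lam mu v) 1 = lam ^- delta * mu * hY v 1.
  by rewrite /hY /torus_act (unsplitK (inr _)).
rewrite !hXa hY0 hY1 !expfzMl; case: ifP => _; first by rewrite mulrACA.
have -> : (lam ^- delta) ^ d2 = (lam ^ (delta%:Z * d2))^-1.
  by rewrite exprz_inv -invr_expz -exprz_exp.
rewrite [lam ^ (_ + _)]expfzDr // [LHS]mulrACA; congr (_ * _).
by rewrite -mulrA mulVKf ?expfz_neq0.
Qed.

Lemma coord_sect (L : fieldType) (delta : nat) (p : chart) (z : 'I_2 -> L) :
  coord delta p (sect p z) =1 z.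
Proof.
move=> k; case: p => i j /=; rewrite /hX /hY /sect !(unsplitK (inl _)).
rewrite !(unsplitK (inr _)) /=.
rewrite eqxx expr1n divr1 !mul1r.
have -> : (other i == i) = false by case: i => -[|[]].
case: k => -[|[|//]] hk; case: j => -[|[|//]] hj //=; rewrite ?divr1.
- by congr z; apply: val_inj.
- by congr z; apply: val_inj.
- by congr z; apply: val_inj.
by congr z; apply: val_inj.
Qed.

Lemma sect_coord (L : fieldType) (delta : nat) (p : chart)
    (v : 'I_(2 + 2) -> L) :
  hX v p.1 != 0 -> hY v p.2 != 0 ->
  exists lam mu : L,
    [/\ lam != 0, mu != 0
      & sect p (coord delta p v) =1 torus_act delta lam mu v].
Proof.
case: p => i j /= hi hj; have hd : hX v i ^+ delta != 0 by rewrite expf_neq0.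
exists (hX v i)^-1.
exists (if j == 0 then (hY v 0)^-1 else (hX v i ^+ delta * hY v 1)^-1).
have ord2 (k : 'I_2) : k = 0 \/ k = 1.
  by case: k => -[|[|//]] h; [left | right]; apply: val_inj.
split=> [||k]; rewrite ?invr_eq0 //.
  by case: (ord2 j) hj => -> /= hj; rewrite invr_eq0 ?mulf_neq0.
rewrite /sect /torus_act /coord; case: (split k) => l /=.
  case: (ord2 i) hi => {hd} -> hi; case: (ord2 l) => -> /=;
    rewrite ?mulVf // [RHS]mulrC; congr (hX v _ / _); exact: val_inj.
rewrite -exprVn invrK.
case: (ord2 j) hj => -> hj; case: (ord2 l) => -> /=; rewrite ?mulVf //.
- by rewrite mulrAC.
- by rewrite mulrC.
- by rewrite invfM mulrA divff // mul1r mulVf.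
Qed.

(* The coordinates of the chart q as rational functions of those of p. *)
Definition transition (C : fieldType) (delta : nat) (p q : chart) :
    'I_2 -> ratfun C 2 :=
  coord delta q (sect p (@gen C 2)).

Definition frame_on (C : fieldType) (delta : nat) (d1 d2 : int)
    (q p : chart) : ratfun C 2 :=
  frame delta d1 d2 q (sect p (@gen C 2)).

(* Global sections of Theta(d1, d2): local expressions v_p (x) frame_p which
   agree on the overlaps. *)
Definition twisted_vfield (C : fieldType) (delta : nat) (d1 d2 : int)
    (v : chart -> 'rV[{mpoly C[2]}]_2) : Prop :=
  forall (p q : chart) (k : 'I_2),
    frame_on C delta d1 d2 q p * ratsubst (transition C delta p q) (v q 0 k) =
    frame_on C delta d1 d2 p p * lie (v p) (transition C delta p q k).

(* Global sections of Omega^1(d1, d2). *)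
Definition twisted_form (C : fieldType) (delta : nat) (d1 d2 : int)
    (eta : chart -> 'rV[{mpoly C[2]}]_2) : Prop :=
  forall p q : chart,
    frame_on C delta d1 d2 q p *: pullback (transition C delta p q) (eta q) =
    frame_on C delta d1 d2 p p *: map_mx (fun f => f%:F) (eta p).

(* Foliations with tangent sheaf O(l1, l2), represented by a nonzero section;
   equality in Fol is [same_foliation]. *)
Record foliation (C : fieldType) (delta : nat) (l1 l2 : int) := Foliation {
  fol_section : chart -> 'rV[{mpoly C[2]}]_2;
  fol_sectionP : twisted_vfield delta (- l1) (- l2) fol_section;
  fol_section_neq0 : exists p, fol_section p != 0
}.

Definition same_foliation (C : fieldType) (delta : nat) (l1 l2 : int)
    (F G : foliation C delta l1 l2) : Prop :=
  exists2 c : C, c != 0 & forall p, fol_section G p = c%:MP *: fol_section F p.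

(* The local vector field depends on the local generator of O(- l1, - l2), which
   is the frame up to a nowhere vanishing function. *)
Definition vfield_defines (C : fieldType) (delta : nat) (l1 l2 : int)
    (F : foliation C delta l1 l2) (p : chart)
    (v : 'rV[{mpoly C[2]}]_2) : Prop :=
  exists2 u : {mpoly C[2]}, nowhere_zero u & fol_section F p = u *: v.

Definition form_defines (C : fieldType) (delta : nat) (l1 l2 : int)
    (F : foliation C delta l1 l2) (p : chart)
    (eta : 'rV[{mpoly C[2]}]_2) : Prop :=
  exists (v : 'rV[{mpoly C[2]}]_2) (w : {mpoly C[2]}),
    [/\ vfield_defines F p v, nowhere_zero w & eta = contract w v].

(* The canonical sheaf being O(delta - 2, -2), the annihilator of F is a section
   of Omega^1(- l1 + 2 - delta, - l2 + 2). *)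
Definition annihilator (C : fieldType) (delta : nat) (l1 l2 : int)
    (F : foliation C delta l1 l2)
    (eta : chart -> 'rV[{mpoly C[2]}]_2) : Prop :=
  twisted_form delta (- l1 + 2 - delta%:Z) (- l2 + 2) eta /\
  forall p, form_defines F p (eta p).

(* Omega = A_0 dX_0 + A_1 dX_1 + B_0 dY_0 + B_1 dY_1, with coefficients listed
   in this order, is the pullback of the annihilator of F by the quotient map:
   the frame becomes a Laurent monomial in X and Y. *)
Definition determines (C : fieldType) (delta : nat) (l1 l2 : int)
    (Omega : 'rV[{mpoly C[2 + 2]}]_(2 + 2))
    (F : foliation C delta l1 l2) : Prop :=
  exists2 eta, annihilator F eta &
    forall p : chart,
      map_mx (fun f => f%:F) Omega =
      frame delta (- l1 + 2 - delta%:Z) (- l2 + 2) p (@gen C (2 + 2)) *: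
        pullback (coord delta p (@gen C (2 + 2))) (eta p).

Definition varX (C : fieldType) (i : 'I_2) : {mpoly C[2 + 2]} := 'X_(lshift 2 i).
Definition varY (C : fieldType) (j : 'I_2) : {mpoly C[2 + 2]} := 'X_(rshift 2 j).

Definition bihomogeneous (C : fieldType) (delta : nat) (d1 d2 : int)
    (H : {mpoly C[2 + 2]}) : Prop :=
  forall m : 'X_{1..2 + 2}, m \in msupp H ->
    (m (lshift 2 0))%:Z + (m (lshift 2 1))%:Z
      - delta%:Z * (m (rshift 2 1))%:Z = d1
    /\ (m (rshift 2 0))%:Z + (m (rshift 2 1))%:Z = d2.

Definition dehom (C : fieldType) (p : chart) (H : {mpoly C[2 + 2]}) :
    {mpoly C[2]} :=
  H \mPo [tuple sect p (fun k => 'X_k) l | l < 2 + 2].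

(* Main.v *)
Require Import Defs.
From HB Require Import structures.
From mathcomp Require Import all_boot all_order all_algebra.
From mathcomp Require Import reals complex.
From mathcomp Require Import generic_quotient mpoly ring.

(** On U_ij a section of the twisted tangent sheaf is a vector field s_ij in the
    coordinates x_ij, y_ij. Contract it with the 2-form
    (-1)^(i+j) dx_ij /\ dy_ij. The Jacobian of a change of charts is, up to the
    monomial which is the transition function of O(2 - delta, 2), the product of
    the signs of the two charts; hence the contractions eta_ij glue to a section of
    Omega^1(d1 + 2 - delta, d2 + 2) ([contract_twisted_form]).

    Pulling back eta_ij along the quotient map, the chain rule and the
    invariance of the coordinates under the torus show that all four charts give
    the same 1-form Omega in X_0, X_1, Y_0, Y_1 ([twisted_form_pullback]). A
    priori its coefficients are rational, but computed on U_ij they have only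
    monomials in X_i and Y_j as denominators; a rational function with this
    property for all (i, j) is a polynomial ([regular_everywhere]).

    Everything else is read off one chart at a time. With i', j' the other
    indices, X_i' occurs in x_ij = X_i' / X_i only, and Y_j' in y_ij only.
    Therefore the coefficient of dX_i' (resp. dY_j') is a Laurent monomial in
    X_i and Y_j times the first (resp. second) coefficient of eta_ij evaluated
    at x_ij, y_ij. Such a product has the bi-degree of the monomial and
    dehomogenizes to that coefficient ([section_of_chart]); this yields the
    bi-degrees, the local equations Omega_ij, and the fact that Omega determines
    all the eta_ij ([total_form_dehom]). The two linear relations express that
    the Euler fields of the torus action kill the invariant functions x_ij and
    y_ij ([euler_identities]).

    For uniqueness, a nowhere vanishing polynomial over an algebraically closed
    field is constant ([nowhere_zero_const]), so every admissible local
    expression of the annihilator is a constant multiple of eta_ij. One chart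
    already determines Omega, so Omega is unique up to a scalar; and when Omega
    also comes from a second foliation, the constants found on the four charts
    coincide because each of them is the ratio of the same two global forms. *)

Set Implicit Arguments.
Unset Strict Implicit.
Unset Printing Implicit Defensive.

Import GRing.Theory.

Local Open Scope ring_scope.
Local Open Scope complex_scope.

(** * Morphisms out of a field of fractions *)

Lemma frac_numdenP (R : idomainType) (f : {fraction R}) :
  f = (\n_(repr f))%:F / (\d_(repr f))%:F.
Proof.
set a := \n_(repr f); set b := \d_(repr f).
have bF : b%:F != 0 by rewrite tofrac_eq0; exact: denom_ratioP.
have -> : f = (\pi_({fraction R}) (repr f))%qT by rewrite reprK.
apply: (mulIf bF); rewrite mulfVK // -[repr f in LHS]Ratio_numden -/a -/b.
have b0 : b != 0 by exact: denom_ratioP.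
rewrite !piE /FracField.mulf !numden_Ratio ?oner_eq0 //.
apply/eqmodP; rewrite /= FracField.equivfE !numden_Ratio ?mulr1 ?oner_eq0 //.
by rewrite mulrC.
Qed.

Lemma subf_div (K : fieldType) (p q a b : K) :
  q != 0 -> b != 0 -> p / q - a / b = (p * b - a * q) / (q * b).
Proof. by move=> q0 b0; field; rewrite q0 b0. Qed.

Lemma fracP (R : idomainType) (f : {fraction R}) :
  exists p q : R, q != 0 /\ f = p%:F / q%:F.
Proof.
exists \n_(repr f), \d_(repr f).
by split; [exact: denom_ratioP|exact: frac_numdenP].
Qed.

Definition fracmap (R : idomainType) (L : fieldType) (h : {rmorphism R -> L})
    of injective h : {fraction R} -> L :=
  fun f => h \n_(repr f) / h \d_(repr f).

Lemma fracmap_div (R : idomainType) (L : fieldType) (h : {rmorphism R -> L})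
    (hI : injective h) (p q : R) :
  q != 0 -> fracmap hI (p%:F / q%:F) = h p / h q.
Proof.
move=> q0; rewrite /fracmap; set f := p%:F / q%:F.
have := frac_numdenP f; set a := \n_(repr f); set b := \d_(repr f) => ef.
have b0 : b != 0 by exact: denom_ratioP.
have h0 x : x != 0 -> h x != 0 by rewrite -(inj_eq hI) rmorph0.
apply/eqP; rewrite eqr_div ?h0 // -!rmorphM (inj_eq hI) -tofrac_eq !tofracM.
by rewrite -eqr_div ?tofrac_eq0 // -ef.
Qed.

Lemma fracmap_zmod_morphism (R : idomainType) (L : fieldType)
    (h : {rmorphism R -> L}) (hI : injective h) : zmod_morphism (fracmap hI).
Proof.
move=> f g; have [p [q [q0 ->]]] := fracP f; have [a [b [b0 ->]]] := fracP g.
have h0 x : x != 0 -> h x != 0 by rewrite -(inj_eq hI) rmorph0.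
rewrite subf_div ?tofrac_eq0 // -!tofracM -tofracB.
by rewrite !fracmap_div ?mulf_neq0 // rmorphB !rmorphM subf_div ?h0.
Qed.

Lemma fracmap_monoid_morphism (R : idomainType) (L : fieldType)
    (h : {rmorphism R -> L}) (hI : injective h) : monoid_morphism (fracmap hI).
Proof.
split=> [|f g].
  by rewrite -[1]divr1 -tofrac1 fracmap_div ?oner_neq0 // rmorph1 divr1.
have [p [q [q0 ->]]] := fracP f; have [a [b [b0 ->]]] := fracP g.
by rewrite mulf_div -!tofracM !fracmap_div ?mulf_neq0 // !rmorphM mulf_div.
Qed.

HB.instance Definition _ (R : idomainType) (L : fieldType)
    (h : {rmorphism R -> L}) (hI : injective h) :=
  GRing.isZmodMorphism.Build {fraction R} L (fracmap hI)
    (fracmap_zmod_morphism hI).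
HB.instance Definition _ (R : idomainType) (L : fieldType)
    (h : {rmorphism R -> L}) (hI : injective h) :=
  GRing.isMonoidMorphism.Build {fraction R} L (fracmap hI)
    (fracmap_monoid_morphism hI).

Lemma fracmap_tofrac (R : idomainType) (L : fieldType) (h : {rmorphism R -> L})
    (hI : injective h) (p : R) : fracmap hI p%:F = h p.
Proof.
by rewrite -[p%:F]divr1 -tofrac1 fracmap_div ?oner_neq0 // rmorph1 divr1.
Qed.

(** * Substitution of rational functions in polynomials *)

Lemma mpoly_ring_ind (n : nat) (C : comNzRingType) (P : {mpoly C[n]} -> Prop) :
  (forall c, P c%:MP) -> (forall k, P 'X_k) ->
  (forall p q, P p -> P q -> P (p + q)) ->
  (forall p q, P p -> P q -> P (p * q)) -> forall p, P p.
Proof.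
move=> PC PX PD PM; have P1 : P 1 by rewrite -mpolyC1.
have PXn q m : P q -> P (q ^+ m).
  by move=> Pq; elim: m => [|m IH]; rewrite ?expr0 ?exprS; auto.
move=> p; rewrite (mpolyE p); apply: (big_ind P) => [||m _] //.
  by rewrite -mpolyC0.
rewrite -mul_mpolyC mpolyXE_id; apply: (PM) => //.
by apply: (big_ind P) => // i _; exact: PXn.
Qed.

Lemma ratsubst_is_zmod_morphism (C : fieldType) (n m : nat)
    (z : 'I_n -> ratfun C m) :
  zmod_morphism (ratsubst z).
Proof. exact: (raddfB (mmap (@FracField.tofrac _ \o @mpolyC m C) z)). Qed.

Lemma ratsubst_is_monoid_morphism (C : fieldType) (n m : nat)
    (z : 'I_n -> ratfun C m) :
  monoid_morphism (ratsubst z).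
Proof.
split; first exact: (rmorph1 (mmap (@FracField.tofrac _ \o @mpolyC m C) z)).
exact: (rmorphM (mmap (@FracField.tofrac _ \o @mpolyC m C) z)).
Qed.

HB.instance Definition _ (C : fieldType) (n m : nat) (z : 'I_n -> ratfun C m) :=
  GRing.isZmodMorphism.Build {mpoly C[n]} (ratfun C m) (ratsubst z)
    (ratsubst_is_zmod_morphism z).
HB.instance Definition _ (C : fieldType) (n m : nat) (z : 'I_n -> ratfun C m) :=
  GRing.isMonoidMorphism.Build {mpoly C[n]} (ratfun C m) (ratsubst z)
    (ratsubst_is_monoid_morphism z).

Lemma ratsubstC (C : fieldType) (n m : nat) (z : 'I_n -> ratfun C m) (c : C) :
  ratsubst z c%:MP = (c%:MP)%:F.
Proof. exact: (mmapC z (@FracField.tofrac _ \o @mpolyC m C)). Qed.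

Lemma ratsubstX (C : fieldType) (n m : nat) (z : 'I_n -> ratfun C m)
    (k : 'I_n) :
  ratsubst z 'X_k = z k.
Proof.
by rewrite [LHS](mmapX z (@FracField.tofrac _ \o @mpolyC m C)) mmap1U.
Qed.

Lemma ratsubstD (C : fieldType) (n m : nat) (z : 'I_n -> ratfun C m) :
  {morph ratsubst z : p q / p + q}.
Proof. exact: (rmorphD (ratsubst z)). Qed.

Lemma ratsubstM (C : fieldType) (n m : nat) (z : 'I_n -> ratfun C m) :
  {morph ratsubst z : p q / p * q}.
Proof. exact: (rmorphM (ratsubst z)). Qed.

Lemma eq_ratsubst (C : fieldType) (n m : nat) (z z' : 'I_n -> ratfun C m) :
  z =1 z' -> ratsubst z =1 ratsubst z'.
Proof.
move=> e; apply: mpoly_ring_ind => [c|k|p q hp hq|p q hp hq].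
- by rewrite !ratsubstC.
- by rewrite !ratsubstX.
- by rewrite !ratsubstD hp hq.
by rewrite !ratsubstM hp hq.
Qed.

Lemma rmorph_ratsubst (C : fieldType) (n m r : nat) (z : 'I_n -> ratfun C m)
    (psi : {rmorphism ratfun C m -> ratfun C r}) (p : {mpoly C[n]}) :
  (forall c, psi (c%:MP)%:F = (c%:MP)%:F) ->
  psi (ratsubst z p) = ratsubst (psi \o z) p.
Proof.
move=> psiC; elim/mpoly_ring_ind: p => [c|k|p q hp hq|p q hp hq].
- by rewrite !ratsubstC.
- by rewrite !ratsubstX.
- by rewrite !ratsubstD rmorphD hp hq.
by rewrite !ratsubstM rmorphM hp hq.
Qed.

(** * Partial derivatives of rational functions *)

Lemma ratderiv_tofrac (C : fieldType) (n : nat) (k : 'I_n) (p : {mpoly C[n]}) :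
  ratderiv k p%:F = (mderiv k p)%:F.
Proof.
rewrite -[p%:F in LHS]divr1 -tofrac1 ratderiv_div ?oner_neq0 //.
by rewrite -mpolyC1 mderivC mpolyC1 mulr0 subr0 mulr1 expr1n divr1.
Qed.

Lemma ratderivC (C : fieldType) (n : nat) (k : 'I_n) (c : C) :
  ratderiv k (c%:MP)%:F = 0.
Proof. by rewrite ratderiv_tofrac mderivC. Qed.

Lemma ratderiv_gen (C : fieldType) (n : nat) (k l : 'I_n) :
  ratderiv k (gen C l) = (k == l)%:R.
Proof.
rewrite /gen ratderiv_tofrac mderivX mnm1E eq_sym.
case: eqP => [->|_]; last first.
  by rewrite scale0r tofrac0.
have -> : (U_(l) - U_(l))%MM = 0%MM :> 'X_{1..n}.
  by apply/mnmP=> i; rewrite mnmBE subnn mnm0E.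
by rewrite mpolyX0 scale1r tofrac1.
Qed.

Lemma quotient_ruleD (K : fieldType) (p q a b p' q' a' b' : K) :
  q != 0 -> b != 0 ->
  ((p' * b + p * b' + (a' * q + a * q')) * (q * b)
    - (p * b + a * q) * (q' * b + q * b')) / (q * b) ^+ 2
  = (p' * q - p * q') / q ^+ 2 + (a' * b - a * b') / b ^+ 2.
Proof. by move=> q0 b0; field; rewrite q0 b0. Qed.

Lemma quotient_ruleM (K : fieldType) (p q a b p' q' a' b' : K) :
  q != 0 -> b != 0 ->
  ((p' * a + p * a') * (q * b) - p * a * (q' * b + q * b')) / (q * b) ^+ 2
  = (p' * q - p * q') / q ^+ 2 * (a / b)
    + p / q * ((a' * b - a * b') / b ^+ 2).
Proof. by move=> q0 b0; field; rewrite q0 b0. Qed.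

Lemma ratderivD (C : fieldType) (n : nat) (k : 'I_n) (f g : ratfun C n) :
  ratderiv k (f + g) = ratderiv k f + ratderiv k g.
Proof.
have [p [q [q0 ->]]] := fracP f; have [a [b [b0 ->]]] := fracP g.
rewrite addf_div ?tofrac_eq0 // -!tofracM -tofracD !ratderiv_div ?mulf_neq0 //.
rewrite !mderivD !mderivM !tofracXn !(tofracB, tofracM, tofracD).
by rewrite quotient_ruleD ?tofrac_eq0.
Qed.

Lemma ratderivM (C : fieldType) (n : nat) (k : 'I_n) (f g : ratfun C n) :
  ratderiv k (f * g) = ratderiv k f * g + f * ratderiv k g.
Proof.
have [p [q [q0 ->]]] := fracP f; have [a [b [b0 ->]]] := fracP g.
rewrite mulf_div -!tofracM !ratderiv_div ?mulf_neq0 //.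
rewrite !mderivM !tofracXn !(tofracB, tofracM, tofracD).
by rewrite quotient_ruleM ?tofrac_eq0.
Qed.

Lemma ratderivV (C : fieldType) (n : nat) (k : 'I_n) (f : ratfun C n) :
  f != 0 -> ratderiv k f^-1 = - (ratderiv k f / f ^+ 2).
Proof.
move=> f0; have := ratderivM k f f^-1.
rewrite mulfV // -tofrac1 -mpolyC1 ratderivC => /esym/eqP.
rewrite addrC addr_eq0 => /eqP h; apply: (mulfI f0).
by rewrite h mulrN expr2 invfM mulrCA mulVKf.
Qed.

Lemma power_rule_step (K : fieldType) (f d u r : K) :
  f != 0 -> d * u + f * (r * (u / f) * d) = (r + 1) * (f * u / f) * d.
Proof. by move=> f0; field. Qed.

Lemma ratderivXn (C : fieldType) (n : nat) (k : 'I_n) (f : ratfun C n) r :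
  f != 0 -> ratderiv k (f ^+ r) = r%:R * (f ^+ r / f) * ratderiv k f.
Proof.
move=> f0; elim: r => [|r IH].
  by rewrite expr0 -tofrac1 -mpolyC1 ratderivC !mul0r.
by rewrite exprS ratderivM IH -natr1 power_rule_step.
Qed.

Lemma ratderiv_ratsubst (C : fieldType) (n m : nat) (z : 'I_n -> ratfun C m)
    (l : 'I_m) (p : {mpoly C[n]}) :
  ratderiv l (ratsubst z p) =
    \sum_k ratsubst z (mderiv k p) * ratderiv l (z k).
Proof.
elim/mpoly_ring_ind: p => [c|k|p q hp hq|p q hp hq].
- rewrite ratsubstC ratderivC big1 // => k _.
  by rewrite mderivC [ratsubst z 0]raddf0 mul0r.
- rewrite ratsubstX (bigD1 k) //= big1 => [|i ik].
    have := ratderiv_gen C k k; rewrite /gen ratderiv_tofrac eqxx => /eqP.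
    rewrite -tofrac1 tofrac_eq => /eqP ->.
    by rewrite [ratsubst z 1]rmorph1 mul1r addr0.
  have := ratderiv_gen C i k; rewrite /gen ratderiv_tofrac (negbTE ik) => /eqP.
  by rewrite -tofrac0 tofrac_eq => /eqP ->; rewrite [ratsubst z 0]raddf0 mul0r.
- rewrite ratsubstD ratderivD hp hq -big_split /=; apply: eq_bigr => k _.
  by rewrite mderivD ratsubstD mulrDl.
rewrite ratsubstM ratderivM hp hq mulr_suml mulr_sumr -big_split /=.
apply: eq_bigr => k _.
rewrite mderivM ratsubstD !ratsubstM mulrDl.
by move: (ratderiv l (z k)) => d; rewrite mulrAC mulrA.
Qed.

(** Both sides are derivations along [psi] as functions of [f], and they agree
    on polynomials; the Leibniz rule applied to [f * q = p] forces them to agree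
    on [f = p / q]. *)
Lemma chain_rule (C : fieldType) (n m : nat)
    (psi : {rmorphism ratfun C n -> ratfun C m}) (l : 'I_m) (f : ratfun C n) :
  (forall c, psi (c%:MP)%:F = (c%:MP)%:F) ->
  ratderiv l (psi f) = \sum_k psi (ratderiv k f) * ratderiv l (psi (gen C k)).
Proof.
move=> psiC.
have psi_poly p : psi p%:F = ratsubst (psi \o @gen C n) p.
  rewrite -(rmorph_ratsubst _ _ psiC); apply: (congr1 psi).
  elim/mpoly_ring_ind: p => [c|k|p q hp hq|p q hp hq].
  - by rewrite ratsubstC.
  - by rewrite ratsubstX.
  - by rewrite ratsubstD -hp -hq tofracD.
  by rewrite ratsubstM -hp -hq tofracM.
have chain_poly p : ratderiv l (psi p%:F) =
    \sum_k psi (ratderiv k p%:F) * ratderiv l (psi (gen C k)).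
  rewrite psi_poly ratderiv_ratsubst; apply: eq_bigr => k _.
  by rewrite ratderiv_tofrac psi_poly.
have [p [q [q0 ef]]] := fracP f.
have fq : f * q%:F = p%:F by rewrite ef mulfVK ?tofrac_eq0.
have q0' : psi q%:F != 0 by rewrite fmorph_eq0 tofrac_eq0.
pose D g := \sum_k psi (ratderiv k g) * ratderiv l (psi (gen C k)).
have DM g h : D (g * h) = D g * psi h + psi g * D h.
  rewrite /D mulr_suml mulr_sumr -big_split /=; apply: eq_bigr => k _.
  rewrite ratderivM; move: (ratderiv k g) (ratderiv k h) => a b.
  move: (ratderiv l _) => d.
  by rewrite rmorphD !rmorphM mulrDl mulrAC mulrA.
have := ratderivM l (psi f) (psi q%:F).
rewrite -rmorphM fq !chain_poly -/(D _) -/(D _) -fq DM => /addIr.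
by move/(mulIf q0').
Qed.

(** * Bi-degrees *)

Lemma ord2P (k : 'I_2) : k = 0 \/ k = 1.
Proof. by case: k => -[|[|//]] h; [left | right]; apply: val_inj. Qed.

Lemma other0 : other 0 = 1. Proof. exact: val_inj. Qed.
Lemma other1 : other 1 = 0. Proof. exact: val_inj. Qed.

Lemma other_neq (i : 'I_2) : (other i == i) = false.
Proof. by case: (ord2P i) => ->; rewrite ?other0 ?other1. Qed.

(** The weight of Y_j under the first factor of the torus. *)
Definition Yweight (delta : nat) (j : 'I_2) : int :=
  if j == 0 then 0 else - delta%:Z.

Lemma frameE (L : fieldType) (delta : nat) (e1 e2 : int) (p : chart)
    (v : 'I_(2 + 2) -> L) :
  frame delta e1 e2 p v =
    hX v p.1 ^ (e1 - Yweight delta p.2 * e2) * hY v p.2 ^ e2.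
Proof.
case: p => i j; rewrite /frame /Yweight /=; case: (ord2P j) => -> /=.
  by rewrite mul0r subr0.
by rewrite mulNr opprK.
Qed.

Lemma bihomogeneousD (C : fieldType) (delta : nat) (e1 e2 : int)
    (H K : {mpoly C[2 + 2]}) :
  bihomogeneous delta e1 e2 H -> bihomogeneous delta e1 e2 K ->
  bihomogeneous delta e1 e2 (H + K).
Proof.
move=> hH hK m /msuppD_le; rewrite mem_cat => /orP[]; [exact: hH|exact: hK].
Qed.

Lemma bihomogeneousM (C : fieldType) (delta : nat) (d1 d2 e1 e2 : int)
    (H K : {mpoly C[2 + 2]}) :
  bihomogeneous delta d1 d2 H -> bihomogeneous delta e1 e2 K ->
  bihomogeneous delta (d1 + e1) (d2 + e2) (H * K).
Proof.
move=> hH hK m /msuppM_le /allpairsP[[m1 m2] /= [/hH[<- <-] /hK[<- <-] ->]].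
by rewrite !mnmDE !PoszD; split; ring.
Qed.

Lemma bihomogeneousC (C : fieldType) (delta : nat) (c : C) :
  bihomogeneous delta 0 0 (c%:MP : {mpoly C[2 + 2]}).
Proof.
move=> m; rewrite msuppC; case: eqP => // _; rewrite mem_seq1 => /eqP ->.
by rewrite !mnm0E; split; ring.
Qed.

Lemma bihomogeneous_varX (C : fieldType) (delta : nat) (i : 'I_2) :
  bihomogeneous delta 1 0 (varX C i).
Proof.
move=> m; rewrite msuppX mem_seq1 => /eqP ->.
rewrite !mnm1E !eq_lshift !eq_lrshift.
by case: (ord2P i) => ->; split; rewrite ?mulr0.
Qed.

Lemma bihomogeneous_varY (C : fieldType) (delta : nat) (j : 'I_2) :
  bihomogeneous delta (Yweight delta j) 1 (varY C j).
Proof.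
move=> m; rewrite msuppX mem_seq1 => /eqP ->.
rewrite !mnm1E !eq_rshift !eq_rlshift.
by case: (ord2P j) => ->; split; rewrite ?mulr0 ?mulr1 // addr0 add0r.
Qed.

Lemma bihomogeneousXn (C : fieldType) (delta : nat) (e1 e2 : int) (r : nat)
    (H : {mpoly C[2 + 2]}) :
  bihomogeneous delta e1 e2 H ->
  bihomogeneous delta (e1 * r%:Z) (e2 * r%:Z) (H ^+ r).
Proof.
move=> hH; elim: r => [|r IH].
  by rewrite !mulr0 expr0 -mpolyC1; exact: bihomogeneousC.
by rewrite exprS -add1n PoszD !mulrDr !mulr1; exact: bihomogeneousM.
Qed.

(** The support of a polynomial multiplied by a monomial is a translate of its
    support, so the monomial factor only shifts the bi-degree. *)
Lemma bihomogeneous_cancel (C : fieldType) (delta : nat) (d1 d2 e1 e2 : int)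
    (m : 'X_{1..2 + 2}) (H : {mpoly C[2 + 2]}) :
  bihomogeneous delta d1 d2 ('X_[m] : {mpoly C[2 + 2]}) ->
  bihomogeneous delta (d1 + e1) (d2 + e2) (H * 'X_[m]) ->
  bihomogeneous delta e1 e2 H.
Proof.
move=> hm hH m' m'H.
have [|w1 w2] := hm m; first by rewrite msuppX mem_seq1.
have [|] := hH (m + m')%MM; first by rewrite (perm_mem (msuppMX _ _)) map_f.
rewrite !mnmDE !PoszD => h1 h2; split.
  by apply: (addrI d1); rewrite -h1 -w1; ring.
by apply: (addrI d2); rewrite -h2 -w2; ring.
Qed.

(** * Homogenization in a chart *)

(** The polynomial X_i ^ a Y_j ^ b, invertible on the chart; taking it as a
    single monomial gives access to the lemmas on supports. *)
Definition chart_mon (C : fieldType) (p : chart)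
    (a b : nat) : {mpoly C[2 + 2]} :=
  'X_[U_(lshift 2 p.1) *+ a + U_(rshift 2 p.2) *+ b].

Lemma chart_monE (C : fieldType) (p : chart) (a b : nat) :
  chart_mon C p a b = varX C p.1 ^+ a * varY C p.2 ^+ b.
Proof. by rewrite /varX /varY !mpolyXn -mpolyXD. Qed.

Lemma chart_monD (C : fieldType) (p : chart) (a b a' b' : nat) :
  chart_mon C p (a + a') (b + b') = chart_mon C p a b * chart_mon C p a' b'.
Proof. by rewrite !chart_monE !exprD mulrACA. Qed.

Lemma bihomogeneous_chart_mon (C : fieldType) (delta : nat) (p : chart)
    (a b : nat) :
  bihomogeneous delta (a%:Z + Yweight delta p.2 * b%:Z) b%:Z
    (chart_mon C p a b).
Proof.
have := bihomogeneousM
  (bihomogeneousXn (r := a) (@bihomogeneous_varX C delta p.1))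
  (bihomogeneousXn (r := b) (@bihomogeneous_varY C delta p.2)).
by rewrite !mul1r mul0r add0r -chart_monE.
Qed.

Lemma dehomD (C : fieldType) (p : chart) : {morph @dehom C p : H K / H + K}.
Proof. by move=> H K; rewrite /dehom raddfD. Qed.

Lemma dehomM (C : fieldType) (p : chart) : {morph @dehom C p : H K / H * K}.
Proof. by move=> H K; rewrite /dehom rmorphM. Qed.

Lemma dehomXn (C : fieldType) (p : chart) r : {morph @dehom C p : H / H ^+ r}.
Proof. by move=> H; rewrite /dehom rmorphXn. Qed.

Lemma dehomC (C : fieldType) (p : chart) (c : C) : dehom p c%:MP = c%:MP.
Proof. by rewrite /dehom comp_mpolyC. Qed.

Lemma dehom_varX (C : fieldType) (p : chart) (i : 'I_2) :
  dehom p (varX C i) = if i == p.1 then 1 else 'X_0.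
Proof.
rewrite /dehom comp_mpolyXU -tnth_nth tnth_mktuple.
by rewrite /sect (unsplitK (inl _)).
Qed.

Lemma dehom_varY (C : fieldType) (p : chart) (j : 'I_2) :
  dehom p (varY C j) = if j == p.2 then 1 else 'X_1.
Proof.
rewrite /dehom comp_mpolyXU -tnth_nth tnth_mktuple.
by rewrite /sect (unsplitK (inr _)).
Qed.

Lemma dehom_chart_mon (C : fieldType) (p : chart) (a b : nat) :
  dehom p (chart_mon C p a b) = 1.
Proof.
by rewrite chart_monE dehomM !dehomXn dehom_varX dehom_varY !eqxx !expr1n mulr1.
Qed.

Local Notation generic_point C := (@gen C (2 + 2)).
Local Notation chart_coord C delta p := (Defs.coord delta p (generic_point C)).
Local Notation chart_frame C delta e1 e2 p :=
  (frame delta e1 e2 p (generic_point C)).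

Lemma hX_gen (C : fieldType) (i : 'I_2) :
  hX (generic_point C) i = (varX C i)%:F.
Proof. by []. Qed.

Lemma hY_gen (C : fieldType) (j : 'I_2) :
  hY (generic_point C) j = (varY C j)%:F.
Proof. by []. Qed.

Lemma gen_neq0 (C : fieldType) (n : nat) (k : 'I_n) : gen C k != 0.
Proof. by rewrite tofrac_eq0 -msupp_eq0 msuppX. Qed.

(** The powers of X_i and Y_j clear the denominators of f(x_ij, y_ij); they
    become 1 on the section X_i = Y_j = 1, which is why dehomogenizing returns
    [f]. The class of polynomials [f] with these properties is a subring
    containing the constants and the two coordinates. *)
Lemma homogenize (C : fieldType) (delta : nat) (p : chart) (f : {mpoly C[2]}) :
  exists (a b : nat) (g : {mpoly C[2 + 2]}),
    [/\ (chart_mon C p a b)%:F * ratsubst (chart_coord C delta p) f = g%:F,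
        dehom p g = f
      & bihomogeneous delta (a%:Z + Yweight delta p.2 * b%:Z) b%:Z g].
Proof.
move: f; apply: mpoly_ring_ind => [c|k|f f'|f f'].
- exists 0, 0, c%:MP; split; last first.
  + by rewrite mulr0; exact: bihomogeneousC.
  + exact: dehomC.
  by rewrite ratsubstC chart_monE !expr0 mulr1 tofrac1 mul1r.
- rewrite ratsubstX.
  have X0 i : (varX C i)%:F != 0 by exact: gen_neq0.
  have Y0 j : (varY C j)%:F != 0 by exact: gen_neq0.
  case: p => i j; rewrite /Defs.coord /Yweight /=.
  have [->|->] := ord2P k => /=.
  + exists 1%N, 0%N, (varX C (other i)); split.
    * by rewrite chart_monE !hX_gen expr0 expr1 mulr1 mulrC mulfVK.
    * by rewrite dehom_varX other_neq.
    by rewrite mulr0 addr0; exact: bihomogeneous_varX.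
  have [->|->] := ord2P j => /=.
  + exists 0%N, 1%N, (varX C i ^+ delta * varY C 1); split.
    * rewrite chart_monE expr0 expr1 mul1r !hX_gen !hY_gen mulrC mulfVK //.
      by rewrite tofracM tofracXn.
    * by rewrite dehomM dehomXn dehom_varX dehom_varY /= eqxx expr1n mul1r.
    have := bihomogeneousM
      (bihomogeneousXn (r := delta) (@bihomogeneous_varX C delta i))
      (@bihomogeneous_varY C delta 1).
    by rewrite /Yweight /= mul1r mul0r subrr !add0r mul0r.
  exists delta, 1%N, (varY C 0); split.
  + rewrite chart_monE !hX_gen !hY_gen expr1 tofracM tofracXn mulrC mulfVK //.
    by rewrite mulf_neq0 ?expf_neq0.
  + by rewrite dehom_varY.
  by rewrite mulr1 subrr; have := @bihomogeneous_varY C delta 0.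
- move=> [a [b [g [hg dg bg]]]] [a' [b' [g' [hg' dg' bg']]]].
  exists (a + a')%N, (b + b')%N.
  exists (chart_mon C p a' b' * g + chart_mon C p a b * g'); split.
  + rewrite chart_monD ratsubstD tofracD !tofracM -hg -hg'.
    move: (ratsubst _ f) (ratsubst _ f') => x y.
    move: (chart_mon C p a b)%:F (chart_mon C p a' b')%:F => u v.
    by rewrite mulrDr mulrAC -[u * v * y]mulrA mulrC [_ * x]mulrC mulrA.
  + by rewrite dehomD !dehomM !dehom_chart_mon !mul1r dg dg'.
  have h := bihomogeneousM (@bihomogeneous_chart_mon C delta p a' b') bg.
  have h' := bihomogeneousM (@bihomogeneous_chart_mon C delta p a b) bg'.
  rewrite !PoszD mulrDr addrACA; apply: bihomogeneousD h'.
  by rewrite addrC [b%:Z + _]addrC.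
move=> [a [b [g [hg dg bg]]]] [a' [b' [g' [hg' dg' bg']]]].
exists (a + a')%N, (b + b')%N, (g * g'); split.
- by rewrite chart_monD ratsubstM !tofracM -hg -hg' mulrACA.
- by rewrite dehomM dg dg'.
have := bihomogeneousM bg bg'.
by rewrite !PoszD mulrDr addrACA.
Qed.

(** * Change of chart on the total space *)

(** The homogenization of [f] dehomogenizes to [f], so it vanishes only with it:
    the two coordinates of a chart are algebraically independent. *)
Lemma ratsubst_coord_inj (C : fieldType) (delta : nat) (p : chart) :
  injective (ratsubst (chart_coord C delta p)).
Proof.
apply: raddf_inj => f f0.
have [a [b [g [hg dg _]]]] := homogenize delta p f.
move: hg; rewrite f0 mulr0 => /esym/eqP; rewrite tofrac_eq0 => /eqP g0.
by rewrite -dg g0 -mpolyC0 dehomC.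
Qed.

(** The pullback by the quotient map of the rational functions on a chart. *)
Definition chart_pull (C : fieldType) (delta : nat) (p : chart) :
    {rmorphism ratfun C 2 -> ratfun C (2 + 2)} :=
  fracmap (@ratsubst_coord_inj C delta p).

Lemma chart_pullE (C : fieldType) (delta : nat) (p : chart) (f : {mpoly C[2]}) :
  chart_pull C delta p f%:F = ratsubst (chart_coord C delta p) f.
Proof. exact: fracmap_tofrac. Qed.

Lemma chart_pullC (C : fieldType) (delta : nat) (p : chart) (c : C) :
  chart_pull C delta p (c%:MP)%:F = (c%:MP)%:F.
Proof. by rewrite chart_pullE ratsubstC. Qed.

Lemma chart_pull_gen (C : fieldType) (delta : nat) (p : chart) (k : 'I_2) :
  chart_pull C delta p (gen C k) = chart_coord C delta p k.
Proof. by rewrite chart_pullE ratsubstX. Qed.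

Lemma rmorph_coord (K L : fieldType) (psi : {rmorphism K -> L}) (delta : nat)
    (q : chart) (v : 'I_(2 + 2) -> K) (k : 'I_2) :
  psi (Defs.coord delta q v k) = Defs.coord delta q (psi \o v) k.
Proof.
case: q => i j; rewrite /Defs.coord /hX /hY /=.
by do 2?case: ifP => _; rewrite fmorph_div ?rmorphM ?rmorphXn.
Qed.

Lemma rmorph_frame (K L : fieldType) (psi : {rmorphism K -> L}) (delta : nat)
    (e1 e2 : int) (q : chart) (v : 'I_(2 + 2) -> K) :
  psi (frame delta e1 e2 q v) = frame delta e1 e2 q (psi \o v).
Proof. by rewrite !frameE rmorphM !fmorphXz. Qed.

Lemma eq_coord (K : fieldType) (delta : nat) (q : chart)
    (v w : 'I_(2 + 2) -> K) :
  v =1 w -> Defs.coord delta q v =1 Defs.coord delta q w.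
Proof. by move=> e k; case: q => i j; rewrite /Defs.coord /hX /hY !e. Qed.

Lemma eq_frame (K : fieldType) (delta : nat) (e1 e2 : int) (q : chart)
    (v w : 'I_(2 + 2) -> K) :
  v =1 w -> frame delta e1 e2 q v = frame delta e1 e2 q w.
Proof. by move=> e; rewrite !frameE /hX /hY !e. Qed.

(** Restricting to X_i = Y_j = 1 and pulling back by the quotient map moves the
    generic point inside its orbit.  Hence transition functions pull back to
    coordinates, and frames to frames up to a factor depending only on the chart
    [p]. *)
Lemma chart_pull_sect (C : fieldType) (delta : nat) (p : chart) :
  exists lam mu : ratfun C (2 + 2),
    [/\ lam != 0, mu != 0
      & chart_pull C delta p \o sect p (@gen C 2)
        =1 torus_act delta lam mu (generic_point C)].
Proof.
have [||lam [mu [l0 m0 e]]] := @sect_coord _ delta p (generic_point C).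
- exact: gen_neq0.
- exact: gen_neq0.
exists lam, mu; split; [exact: l0|exact: m0|move=> k].
rewrite -e /= /sect; case: (split k) => l; case: ifP => _.
- exact: rmorph1.
- exact: chart_pull_gen.
- exact: rmorph1.
exact: chart_pull_gen.
Qed.

Lemma chart_pull_transition (C : fieldType) (delta : nat) (p q : chart)
    (k : 'I_2) :
  chart_pull C delta p (transition C delta p q k) =
    chart_coord C delta q k.
Proof.
have [lam [mu [l0 m0 e]]] := chart_pull_sect C delta p.
rewrite rmorph_coord (eq_coord _ _ e); exact: (coord_torus_act _ _ _ l0 m0).
Qed.

Lemma chart_pull_frame (C : fieldType) (delta : nat) (e1 e2 : int) (p : chart) :
  exists2 c : ratfun C (2 + 2), c != 0 &
    forall q, chart_pull C delta p (frame_on C delta e1 e2 q p) =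
      c * chart_frame C delta e1 e2 q.
Proof.
have [lam [mu [l0 m0 e]]] := chart_pull_sect C delta p.
exists (lam ^ e1 * mu ^ e2) => [|q].
  exact: mulf_neq0 (expfz_neq0 _ l0) (expfz_neq0 _ m0).
rewrite rmorph_frame (eq_frame _ _ _ _ e).
exact: (frame_torus_act _ _ _ _ _ l0 m0).
Qed.

(** Pull the gluing relation on the chart [p] back to the total space: the
    factor coming from the frames is the same on both sides, and the chain rule
    through the coordinates of [p] rewrites the derivatives of those of [q]. *)
Lemma twisted_form_pullback (C : fieldType) (delta : nat) (e1 e2 : int)
    (eta : chart -> 'rV[{mpoly C[2]}]_2) (p q : chart) :
  twisted_form delta e1 e2 eta ->
  chart_frame C delta e1 e2 q *:
    pullback (chart_coord C delta q) (eta q) =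
  chart_frame C delta e1 e2 p *:
    pullback (chart_coord C delta p) (eta p).
Proof.
move=> tw; have {tw} tw := tw p q; apply/rowP => l; rewrite !mxE.
have [c c0 cE] := chart_pull_frame C delta e1 e2 p.
set psi := chart_pull C delta p.
have subst_q f : ratsubst (chart_coord C delta q) f =
    psi (ratsubst (transition C delta p q) f).
  rewrite (rmorph_ratsubst _ _ (@chart_pullC C delta p)).
  by apply: eq_ratsubst => k; rewrite /= chart_pull_transition.
have deriv_q k : ratderiv l (chart_coord C delta q k) =
    \sum_m psi (ratderiv m (transition C delta p q k)) *
      ratderiv l (chart_coord C delta p m).
  rewrite -(chart_pull_transition C delta p).
  rewrite (chain_rule _ _ (@chart_pullC C delta p)).
  by apply: eq_bigr => m _; rewrite chart_pull_gen.
have psiE := @chart_pullE C delta p (eta p 0 _).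
rewrite -/psi in cE psiE; apply: (mulfI c0).
set D := @ratderiv C (2 + 2) in deriv_q *.
clearbody psi D.
rewrite !mulrA -!cE.
under eq_bigr => k _ do rewrite subst_q deriv_q mulr_sumr.
rewrite exchange_big /= !mulr_sumr; apply: eq_bigr => m _.
have /rowP/(_ m) := tw; rewrite !mxE => /(congr1 psi).
rewrite [psi (_ * (eta p 0 m)%:F)]rmorphM psiE mulrA => <-.
rewrite rmorphM rmorph_sum /= -mulrA mulr_suml; congr (_ * _).
apply: eq_bigr => k _; move: (ratderiv _ _) => d.
by rewrite rmorphM mulrA.
Qed.

Lemma expfz_shift (K : fieldType) (x : K) (u : int) :
  x != 0 -> exists c c' : nat, u = c'%:Z - c%:Z /\ x ^+ c * x ^ u = x ^+ c'.
Proof.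
move=> x0; case: u => n.
  by exists 0%N, n; rewrite subr0 expr0 mul1r.
exists n.+1, 0%N; split; first by rewrite NegzE sub0r.
by rewrite NegzE -exprnN mulfV ?expf_neq0.
Qed.

Lemma frame_shift (C : fieldType) (delta : nat) (e1 e2 : int) (p : chart) :
  exists a b a' b' : nat,
    [/\ (chart_mon C p a b)%:F * chart_frame C delta e1 e2 p =
          (chart_mon C p a' b')%:F,
        e1 = a'%:Z - a%:Z + Yweight delta p.2 * e2 & e2 = b'%:Z - b%:Z].
Proof.
rewrite frameE.
have [a [a' [ea xa]]] := expfz_shift (e1 - Yweight delta p.2 * e2)
  (gen_neq0 C (lshift 2 p.1)).
have [b [b' [eb xb]]] := expfz_shift e2 (gen_neq0 C (rshift 2 p.2)).
exists a, b, a', b'; split=> //; last by rewrite -ea subrK.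
rewrite !chart_monE !tofracM !tofracXn.
rewrite -[(varX C p.1)%:F]hX_gen -[(varY C p.2)%:F]hY_gen.
by rewrite mulrACA xa xb.
Qed.

(** Compare [H] with the homogenization of [f]: they differ by quotients of
    monomials in X_i and Y_j, which dehomogenize to 1 and are bi-homogeneous. *)
Lemma section_of_chart (C : fieldType) (delta : nat) (e1 e2 : int) (p : chart)
    (H : {mpoly C[2 + 2]}) (f : {mpoly C[2]}) :
  H%:F = chart_frame C delta e1 e2 p *
           ratsubst (chart_coord C delta p) f ->
  dehom p H = f /\ bihomogeneous delta e1 e2 H.
Proof.
move=> eH; have [a [b [g [hg dg bg]]]] := homogenize delta p f.
have [c [d [c' [d' [hF -> ->]]]]] := frame_shift C delta e1 e2 p.
have e : H * chart_mon C p (c + a) (d + b) = chart_mon C p c' d' * g.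
  apply/eqP; rewrite -tofrac_eq mulrC chart_monD !tofracM eH -hF -hg.
  move: (frame _ _ _ _ _) (ratsubst _ _) => u v.
  by rewrite mulrACA.
split.
  have := congr1 (dehom p) e.
  by rewrite !dehomM !dehom_chart_mon mulr1 mul1r dg.
apply: (bihomogeneous_cancel
  (@bihomogeneous_chart_mon C delta p (c + a) (d + b))).
rewrite -/(chart_mon C p (c + a) (d + b)) e.
have := bihomogeneousM (@bihomogeneous_chart_mon C delta p c' d') bg.
congr (bihomogeneous _ _ _ _); rewrite !PoszD; ring.
Qed.

(** * Rational functions regular in every chart *)

Lemma mpolyX_divides (R : comNzRingType) (n : nat) (m1 m2 : 'X_{1..n})
    (p q : {mpoly R[n]}) :
  (forall k, m1 k = 0%N \/ m2 k = 0%N) ->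
  'X_[m1] * p = 'X_[m2] * q -> exists r, p = 'X_[m2] * r.
Proof.
move=> disj e; exists (\sum_(m <- msupp p) p@_m *: 'X_[m - m2]).
rewrite {1}(mpolyE p) mulr_sumr !big_seq; apply: eq_bigr => m mp.
rewrite -scalerAr -mpolyXD addmC submK //; apply/mnm_lepP => k.
have [] := disj k => [m1k|-> //].
have : (m1 + m)%MM \in msupp (q * 'X_[m2]).
  by rewrite mulrC -e mulrC (perm_mem (msuppMX _ _)) map_f.
rewrite (perm_mem (msuppMX _ _)) => /mapP[m' _ /mnmP/(_ k)].
by rewrite !mnmDE m1k add0n => ->; rewrite leq_addr.
Qed.

(** Clearing both denominators gives X^m1 g2 = X^m2 g1 with disjoint
    monomials, so X^m2 divides g2. *)
Lemma frac_poly_of_two (C : fieldType) (n : nat) (m1 m2 : 'X_{1..n})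
    (G : ratfun C n) (g1 g2 : {mpoly C[n]}) :
  (forall k, m1 k = 0%N \/ m2 k = 0%N) ->
  ('X_[m1])%:F * G = g1%:F -> ('X_[m2])%:F * G = g2%:F ->
  exists H : {mpoly C[n]}, G = H%:F.
Proof.
move=> disj h1 h2.
have [|r er] := @mpolyX_divides C n m1 m2 g2 g1 disj.
  apply/eqP; rewrite -tofrac_eq !tofracM -h1 -h2.
  by move: ('X_[m1])%:F ('X_[m2])%:F => u v; rewrite mulrCA.
exists r; have m20 : ('X_[m2] : {mpoly C[n]})%:F != 0.
  by rewrite tofrac_eq0 -msupp_eq0 msuppX.
by apply: (mulfI m20); rewrite h2 er tofracM.
Qed.

(** Regularity of a rational function on the part of the total space above a
    chart, where X_i and Y_j do not vanish. *)
Definition regular_on (C : fieldType) (p : chart)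
    (G : ratfun C (2 + 2)) : Prop :=
  exists (a b : nat) (g : {mpoly C[2 + 2]}), (chart_mon C p a b)%:F * G = g%:F.

Lemma regular_onD (C : fieldType) (p : chart) (G K : ratfun C (2 + 2)) :
  regular_on p G -> regular_on p K -> regular_on p (G + K).
Proof.
move=> [a [b [g hg]]] [a' [b' [g' hg']]].
exists (a + a')%N, (b + b')%N.
exists (chart_mon C p a' b' * g + chart_mon C p a b * g').
rewrite chart_monD tofracD !tofracM -hg -hg'.
move: (chart_mon C p a b)%:F (chart_mon C p a' b')%:F => u v.
by rewrite mulrDr mulrAC -[u * v * K]mulrA mulrC [_ * G]mulrC mulrA.
Qed.

Lemma regular_onM (C : fieldType) (p : chart) (G K : ratfun C (2 + 2)) :
  regular_on p G -> regular_on p K -> regular_on p (G * K).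
Proof.
move=> [a [b [g hg]]] [a' [b' [g' hg']]].
exists (a + a')%N, (b + b')%N, (g * g').
by rewrite chart_monD !tofracM -hg -hg' mulrACA.
Qed.

Lemma regular_on_poly (C : fieldType) (p : chart) (g : {mpoly C[2 + 2]}) :
  regular_on p g%:F.
Proof.
by exists 0%N, 0%N, g; rewrite chart_monE !expr0 mulr1 tofrac1 mul1r.
Qed.

Lemma regular_on_sum (C : fieldType) (p : chart) (I : finType)
    (G : I -> ratfun C (2 + 2)) :
  (forall i, regular_on p (G i)) -> regular_on p (\sum_i G i).
Proof.
move=> hG; apply: (big_ind (regular_on p)) => [|G1 G2|i _] //.
  by rewrite -tofrac0; exact: regular_on_poly.
exact: regular_onD.
Qed.

Lemma regular_on_deriv (C : fieldType) (p : chart) (l : 'I_(2 + 2))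
    (G : ratfun C (2 + 2)) :
  regular_on p G -> regular_on p (ratderiv l G).
Proof.
move=> [a [b [g hg]]]; have := ratderivM l (chart_mon C p a b)%:F G.
rewrite hg !ratderiv_tofrac => e.
exists (a + a)%N, (b + b)%N,
  (chart_mon C p a b * mderiv l g - mderiv l (chart_mon C p a b) * g).
rewrite chart_monD tofracB !tofracM e -hg.
move: (ratderiv l G) (chart_mon C p a b)%:F (mderiv _ _)%:F => d u v.
by rewrite mulrDr [u * (v * G)]mulrCA addrAC subrr add0r mulrA.
Qed.

Lemma regular_on_ratsubst (C : fieldType) (delta : nat) (p : chart)
    (f : {mpoly C[2]}) :
  regular_on p (ratsubst (chart_coord C delta p) f).
Proof.
by have [a [b [g [hg _ _]]]] := homogenize delta p f; exists a, b, g.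
Qed.

Lemma regular_on_coord (C : fieldType) (delta : nat) (p : chart) (k : 'I_2) :
  regular_on p (chart_coord C delta p k).
Proof. by rewrite -ratsubstX; exact: regular_on_ratsubst. Qed.

Lemma regular_on_frame (C : fieldType) (delta : nat) (e1 e2 : int) (p : chart) :
  regular_on p (chart_frame C delta e1 e2 p).
Proof.
have [a [b [a' [b' [h _ _]]]]] := frame_shift C delta e1 e2 p.
by exists a, b, (chart_mon C p a' b').
Qed.

Lemma regular_on_pullback (C : fieldType) (delta : nat) (e1 e2 : int)
    (p : chart)
    (eta : 'rV[{mpoly C[2]}]_2) (l : 'I_(2 + 2)) :
  regular_on p ((chart_frame C delta e1 e2 p *:
    pullback (chart_coord C delta p) eta) 0 l).
Proof.
rewrite !mxE; apply: regular_onM; first exact: regular_on_frame.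
apply: regular_on_sum => k; apply: regular_onM.
  exact: regular_on_ratsubst.
exact/regular_on_deriv/regular_on_coord.
Qed.

(** First combine the charts with the same X_i, whose denominators in Y_0 and
    Y_1 are coprime, then the remaining denominators in X_0 and X_1. *)
Lemma regular_everywhere (C : fieldType) (G : ratfun C (2 + 2)) :
  (forall p, regular_on p G) -> exists H : {mpoly C[2 + 2]}, G = H%:F.
Proof.
move=> reg.
have xpow (i : 'I_2) : exists (a : nat) (h : {mpoly C[2 + 2]}),
    ('X_[U_(lshift 2 i) *+ a])%:F * G = h%:F.
  have mnmD (u : 'X_{1..2 + 2}) c d : (u *+ (c + d) = u *+ c + u *+ d)%MM.
    by apply/mnmP => k; rewrite mnmDE !mulmnE mulnDr.
  have [a [b [g hg]]] := reg (i, 0); have [a' [b' [g' hg']]] := reg (i, 1).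
  exists (a + a')%N.
  apply: (@frac_poly_of_two C _ (U_(rshift 2 0) *+ b) (U_(rshift 2 1) *+ b')
    _ ('X_[U_(lshift 2 i) *+ a'] * g) ('X_[U_(lshift 2 i) *+ a] * g')).
  - move=> k; rewrite !mulmnE !mnm1E.
    by have [<-|_] := eqVneq (rshift 2 0) k; [right|left].
  - move: hg; rewrite mnmD /chart_mon /= !mpolyXD !tofracM => <-.
    move: ('X_[_ *+ a])%:F ('X_[_ *+ a'])%:F ('X_[_ *+ b])%:F => u v w.
    by rewrite mulrCA [u * v]mulrC -!mulrA.
  move: hg'; rewrite mnmD /chart_mon /= !mpolyXD !tofracM => <-.
  move: ('X_[_ *+ a])%:F ('X_[_ *+ a'])%:F ('X_[_ *+ b'])%:F => u v w.
  by rewrite mulrCA -!mulrA.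
have [a [h e]] := xpow 0; have [a' [h' e']] := xpow 1.
apply: (frac_poly_of_two _ e e') => k; rewrite !mulmnE !mnm1E.
by have [<-|_] := eqVneq (lshift 2 0) k; [right|left].
Qed.

(** * Jacobians of the changes of charts *)

Lemma quotient_rule_field (K : fieldType) (f g f' g' : K) :
  g != 0 -> f' / g + f * - (g' / g ^+ 2) = (f' * g - f * g') / g ^+ 2.
Proof. by move=> g0; field. Qed.

Lemma ratderiv_quot (C : fieldType) (n : nat) (l : 'I_n) (f g : ratfun C n) :
  g != 0 ->
  ratderiv l (f / g) = (ratderiv l f * g - f * ratderiv l g) / g ^+ 2.
Proof. by move=> g0; rewrite ratderivM ratderivV // quotient_rule_field. Qed.

Lemma ratderiv1 (C : fieldType) (n : nat) (l : 'I_n) :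
  ratderiv l (1 : ratfun C n) = 0.
Proof. by rewrite -tofrac1 -mpolyC1 ratderivC. Qed.

Lemma frameD (K : fieldType) (delta : nat) (a b e f : int) (p : chart)
    (v : 'I_(2 + 2) -> K) :
  hX v p.1 != 0 -> hY v p.2 != 0 ->
  frame delta (a + e) (b + f) p v = frame delta a b p v * frame delta e f p v.
Proof.
move=> X0 Y0; rewrite !frameE mulrACA -!expfzDr //.
by congr (_ ^ _ * _); ring.
Qed.

Lemma hX_sect (C : fieldType) (p : chart) (a : 'I_2) :
  hX (sect p (@gen C 2)) a = if a == p.1 then 1 else gen C 0.
Proof. by rewrite /hX /sect (unsplitK (inl _)). Qed.

Lemma hY_sect (C : fieldType) (p : chart) (b : 'I_2) :
  hY (sect p (@gen C 2)) b = if b == p.2 then 1 else gen C 1.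
Proof. by rewrite /hY /sect (unsplitK (inr _)). Qed.

Lemma hX_sect_neq0 (C : fieldType) (p : chart) (a : 'I_2) :
  hX (sect p (@gen C 2)) a != 0.
Proof. by rewrite hX_sect; case: ifP => _; rewrite ?oner_neq0 ?gen_neq0. Qed.

Lemma hY_sect_neq0 (C : fieldType) (p : chart) (b : 'I_2) :
  hY (sect p (@gen C 2)) b != 0.
Proof. by rewrite hY_sect; case: ifP => _; rewrite ?oner_neq0 ?gen_neq0. Qed.

Lemma ratderiv_hX_sect (C : fieldType) (p : chart) (k a : 'I_2) :
  ratderiv k (hX (sect p (@gen C 2)) a) = ((k == 0) && (a != p.1))%:R.
Proof.
rewrite hX_sect; case: ifP => _ /=; first by rewrite ratderiv1 andbF.
by rewrite ratderiv_gen andbT.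
Qed.

Lemma ratderiv_hY_sect (C : fieldType) (p : chart) (k b : 'I_2) :
  ratderiv k (hY (sect p (@gen C 2)) b) = ((k == 1) && (b != p.2))%:R.
Proof.
rewrite hY_sect; case: ifP => _ /=; first by rewrite ratderiv1 andbF.
by rewrite ratderiv_gen andbT.
Qed.

(** The numerator of the derivative of a quotient of two homogeneous
    coordinates, one of which is 1 and the other the affine coordinate [x]; the
    sign records whether the two charts agree. *)
Lemma sect_wronskian (K : fieldType) (x : K) (i i' : 'I_2) :
  (other i' != i)%:R * (if i' == i then 1 else x)
    - (if other i' == i then 1 else x) * (i' != i)%:R = (-1) ^+ (i + i') :> K.
Proof.
case: (ord2P i) => ->; case: (ord2P i') => ->; rewrite ?other0 ?other1 /=.
all: rewrite ?expr1 ?expr0 ?expr2; ring.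
Qed.

(** The new x-coordinate depends on the old x only, so the Jacobian matrix of a
    change of charts is triangular. *)
Lemma transition0_deriv (C : fieldType) (delta : nat) (p q : chart) :
  ratderiv 0 (transition C delta p q 0) =
    (-1) ^+ (p.1 + q.1) / hX (sect p (@gen C 2)) q.1 ^+ 2
  /\ ratderiv 1 (transition C delta p q 0) = 0.
Proof.
case: q => i' j'; rewrite /transition /Defs.coord /=.
rewrite !ratderiv_quot ?hX_sect_neq0 // !ratderiv_hX_sect /=.
rewrite mul0r mulr0 subrr mul0r.
by rewrite !hX_sect (sect_wronskian _ p.1 i').
Qed.

Lemma ratderivXn_eq0 (C : fieldType) (n : nat) (l : 'I_n) (f : ratfun C n) r :
  f != 0 -> ratderiv l f = 0 -> ratderiv l (f ^+ r) = 0.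
Proof. by move=> f0 h; rewrite ratderivXn // h mulr0. Qed.

Lemma quotient_rule_scalel (K : fieldType) (u a b a' b' : K) :
  b != 0 -> ((0 * a + u * a') * b - u * a * b') / b ^+ 2
            = (a' * b - a * b') * u / b ^+ 2.
Proof. by move=> b0; field. Qed.

Lemma quotient_rule_scaler (K : fieldType) (u a b a' b' : K) :
  u != 0 -> b != 0 ->
  (a' * (u * b) - a * (0 * b + u * b')) / (u * b) ^+ 2
            = (a' * b - a * b') / (u * b ^+ 2).
Proof. by move=> u0 b0; field; rewrite u0 b0. Qed.

Lemma ratderiv_scale_num (C : fieldType) (n : nat) (l : 'I_n)
    (u a b : ratfun C n) :
  b != 0 -> ratderiv l u = 0 ->
  ratderiv l (u * a / b) = (ratderiv l a * b - a * ratderiv l b) * u / b ^+ 2.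
Proof.
move=> b0 du; rewrite ratderiv_quot // ratderivM.
move: (ratderiv l u) (ratderiv l a) (ratderiv l b) du => u' a' b' ->.
exact: quotient_rule_scalel b0.
Qed.

Lemma ratderiv_scale_den (C : fieldType) (n : nat) (l : 'I_n)
    (u a b : ratfun C n) :
  u != 0 -> b != 0 -> ratderiv l u = 0 ->
  ratderiv l (a / (u * b)) =
    (ratderiv l a * b - a * ratderiv l b) / (u * b ^+ 2).
Proof.
move=> u0 b0 du; rewrite (ratderiv_quot _ _ (mulf_neq0 u0 b0)) ratderivM.
move: (ratderiv l u) (ratderiv l a) (ratderiv l b) du => u' a' b' ->.
exact: quotient_rule_scaler u0 b0.
Qed.

Lemma ratderiv_hY_wronskian (C : fieldType) (p : chart) (j' : 'I_2) :
  ratderiv 1 (hY (sect p (@gen C 2)) (other j')) * hY (sect p (@gen C 2)) j'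
    - hY (sect p (@gen C 2)) (other j') * ratderiv 1 (hY (sect p (@gen C 2)) j')
  = (-1) ^+ (p.2 + j').
Proof. by rewrite !ratderiv_hY_sect !hY_sect (sect_wronskian _ p.2 j'). Qed.

Lemma transition1_deriv (C : fieldType) (delta : nat) (p q : chart) :
  ratderiv 1 (transition C delta p q 1) =
    (-1) ^+ (p.2 + q.2) *
    (hX (sect p (@gen C 2)) q.1 ^ (delta%:Z + Yweight delta q.2 *+ 2)
      / hY (sect p (@gen C 2)) q.2 ^+ 2).
Proof.
have X0 := hX_sect_neq0 C p q.1.
have Yn0 := hY_sect_neq0 C p.
have dX : ratderiv 1 (hX (sect p (@gen C 2)) q.1 ^+ delta) = 0.
  by rewrite ratderivXn_eq0 // ratderiv_hX_sect.
have w := ratderiv_hY_wronskian C p q.2.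
have Xd0 : hX (sect p (@gen C 2)) q.1 ^+ delta != 0 by rewrite expf_neq0.
move: q X0 dX w Xd0 => [i' j'] /= X0 dX w Xd0.
rewrite /transition /Defs.coord /Yweight /=.
case: (ord2P j') w => -> w.
  rewrite !eqxx mul0rn addr0 mulrA -w other0.
  exact: ratderiv_scale_num (Yn0 0) dX.
rewrite [1 == 0]/= [X in _ ^ X](_ : _ = - delta%:Z); last first.
  by rewrite mulr2n; ring.
rewrite -exprnN -invfM -w other1.
exact: ratderiv_scale_den Xd0 (Yn0 1) dX.
Qed.

(** The sign by which dx_ij /\ dy_ij must be multiplied in order to glue to a
    generator of the canonical sheaf twisted by O(2 - delta, 2). *)
Definition chart_sign (K : pzRingType) (p : chart) : K := (-1) ^+ (p.1 + p.2).

Lemma chart_sign_mul (K : comPzRingType) (p q : chart) :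
  chart_sign K q * ((-1) ^+ (p.1 + q.1) * (-1) ^+ (p.2 + q.2)) = chart_sign K p.
Proof.
rewrite /chart_sign -!exprD -[LHS]signr_odd -[RHS]signr_odd !oddD.
by congr (_ ^+ nat_of_bool _); case: (odd p.1); case: (odd p.2);
  case: (odd q.1); case: (odd q.2).
Qed.

Lemma jacobian_cancel (K : fieldType) (x y s s1 s2 : K) (e : int) :
  x != 0 -> y != 0 ->
  s * (x ^ (2 - e) * y ^ 2) * (s1 / x ^+ 2 * (s2 * (x ^ e / y ^+ 2)))
    = s * (s1 * s2).
Proof.
move=> x0 y0; rewrite expfzDr // -invr_expz -!exprnP.
by field; rewrite x0 y0 expfz_neq0.
Qed.

Lemma jacobian_frame (C : fieldType) (delta : nat) (p q : chart) :
  chart_sign _ q * frame_on C delta (2 - delta%:Z) 2 q p *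
    (ratderiv 0 (transition C delta p q 0)
      * ratderiv 1 (transition C delta p q 1))
  = chart_sign _ p.
Proof.
have [-> _] := transition0_deriv C delta p q.
rewrite (transition1_deriv C) /frame_on frameE.
have X0 := hX_sect_neq0 C p q.1; have Y0 := hY_sect_neq0 C p q.2.
move: (hX _ q.1) (hY _ q.2) X0 Y0 => x y x0 y0.
(* Brings out the exponent occurring in the derivative, for the two powers to
   cancel. *)
rewrite (_ : 2 - delta%:Z - _ = 2 - (delta%:Z + Yweight delta q.2 *+ 2));
  last first.
  by rewrite mulr2n; ring.
by rewrite (jacobian_cancel _ _ _ _ x0 y0) chart_sign_mul.
Qed.

Lemma frame_on_diag (C : fieldType) (delta : nat) (e1 e2 : int) (p : chart) :
  frame_on C delta e1 e2 p p = 1.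
Proof. by rewrite /frame_on frameE hX_sect hY_sect !eqxx !exp1rz mulr1. Qed.

Lemma sum_ord2 (V : nmodType) (F : 'I_2 -> V) : \sum_k F k = F 0 + F 1.
Proof.
rewrite big_ord_recl big_ord1; congr (F _ + F _); exact: val_inj.
Qed.

(** How the contraction of an area form by a vector field changes under a
    triangular Jacobian (j_kl): F and G are the transition factors of the
    twisted vector field and of the area form. *)
Lemma contract_transform (K : comPzRingType)
    (F G sp sq j00 j01 j10 j11 a0 a1 v0 v1 : K) :
  F * a0 = 1 * (v0 * j00 + v1 * j10) -> F * a1 = 1 * (v0 * j01 + v1 * j11) ->
  sq * G * (j00 * j11) = sp -> j10 = 0 ->
  F * G * (- (sq * a1) * j00 + sq * a0 * j01) = - (sp * v1)
  /\ F * G * (- (sq * a1) * j10 + sq * a0 * j11) = sp * v0.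
Proof.
move=> e0 e1 <- z; rewrite z mulr0 addr0 mul1r in e0; rewrite mul1r in e1.
rewrite z mulr0 add0r; split.
  transitivity (G * sq * (- (F * a1) * j00 + F * a0 * j01)); first by ring.
  by rewrite e0 e1; ring.
transitivity (G * sq * (F * a0 * j11)); first by ring.
by rewrite e0; ring.
Qed.

Lemma ratsubstN (C : fieldType) (n m : nat) (z : 'I_n -> ratfun C m) :
  {morph ratsubst z : f / - f}.
Proof. exact: (raddfN (ratsubst z)). Qed.

Lemma ratsubst_sign (C : fieldType) (n m : nat) (z : 'I_n -> ratfun C m)
    (p : chart) (f : {mpoly C[n]}) :
  ratsubst z (chart_sign _ p * f) = chart_sign _ p * ratsubst z f.
Proof.
rewrite ratsubstM; congr (_ * _).
by rewrite /chart_sign (rmorphXn (ratsubst z)) (rmorphN1 (ratsubst z)).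
Qed.

Lemma tofrac_sign (C : fieldType) (n : nat) (p : chart) (f : {mpoly C[n]}) :
  (chart_sign _ p * f)%:F = chart_sign _ p * f%:F :> ratfun C n.
Proof. by rewrite tofracM; congr (_ * _); exact: rmorph_sign. Qed.

Lemma contract_twisted_form (C : fieldType) (delta : nat) (d1 d2 : int)
    (s : chart -> 'rV[{mpoly C[2]}]_2) :
  twisted_vfield delta d1 d2 s ->
  twisted_form delta (d1 + 2 - delta%:Z) (d2 + 2)
    (fun p => contract (chart_sign _ p) (s p)).
Proof.
move=> tw p q.
have [_ t01] := transition0_deriv C delta p q.
have J := jacobian_frame C delta p q.
have := tw p q 1; have := tw p q 0.
rewrite !frame_on_diag /lie !sum_ord2 => e0 e1.
have [h0 h1] := contract_transform e0 e1 J t01.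
rewrite scale1r; apply/rowP => l.
have -> : frame_on C delta (d1 + 2 - delta%:Z) (d2 + 2) q p =
    frame_on C delta d1 d2 q p * frame_on C delta (2 - delta%:Z) 2 q p.
  by rewrite -addrA /frame_on frameD ?hX_sect_neq0 ?hY_sect_neq0.
rewrite !mxE sum_ord2 !mxE [0 == 0]/= [1 == 0]/= ratsubstN !ratsubst_sign.
have [->|->] := ord2P l; first by rewrite [LHS]h0 /= tofracN tofrac_sign.
by rewrite [LHS]h1 /= tofrac_sign.
Qed.

(** * Coefficients of a pulled back form *)

Lemma ratderiv_hX_gen (C : fieldType) (l : 'I_(2 + 2)) (a : 'I_2) :
  ratderiv l (hX (generic_point C) a) = (l == lshift 2 a)%:R.
Proof. exact: ratderiv_gen. Qed.

Lemma ratderiv_hY_gen (C : fieldType) (l : 'I_(2 + 2)) (b : 'I_2) :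
  ratderiv l (hY (generic_point C) b) = (l == rshift 2 b)%:R.
Proof. exact: ratderiv_gen. Qed.

Lemma hX_gen_neq0 (C : fieldType) (a : 'I_2) : hX (generic_point C) a != 0.
Proof. exact: gen_neq0. Qed.

Lemma hY_gen_neq0 (C : fieldType) (b : 'I_2) : hY (generic_point C) b != 0.
Proof. exact: gen_neq0. Qed.

Lemma ratderiv_coord0 (C : fieldType) (delta : nat) (p : chart)
    (l : 'I_(2 + 2)) :
  ratderiv l (chart_coord C delta p 0) =
    ((l == lshift 2 (other p.1))%:R * hX (generic_point C) p.1
      - hX (generic_point C) (other p.1) * (l == lshift 2 p.1)%:R)
    / hX (generic_point C) p.1 ^+ 2.
Proof.
case: p => i j; rewrite /Defs.coord /= ratderiv_quot ?hX_gen_neq0 //.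
by rewrite !ratderiv_hX_gen.
Qed.

Lemma ratderiv_coord1 (C : fieldType) (delta : nat) (p : chart)
    (l : 'I_(2 + 2)) :
  l != lshift 2 p.1 ->
  ratderiv l (chart_coord C delta p 1) =
    ((l == rshift 2 (other p.2))%:R * hY (generic_point C) p.2
      - hY (generic_point C) (other p.2) * (l == rshift 2 p.2)%:R)
    * (hX (generic_point C) p.1 ^ (delta%:Z + Yweight delta p.2 *+ 2)
       / hY (generic_point C) p.2 ^+ 2).
Proof.
case: p => i j /= li; rewrite /Defs.coord /Yweight /=.
have du : ratderiv l (hX (generic_point C) i ^+ delta) = 0.
  by rewrite ratderivXn_eq0 ?hX_gen_neq0 // ratderiv_hX_gen (negbTE li).
have u0 : hX (generic_point C) i ^+ delta != 0.
  by rewrite expf_neq0 ?hX_gen_neq0.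
rewrite -!ratderiv_hY_gen; have [->|->] := ord2P j.
  rewrite !eqxx mul0rn addr0 mulrA other0.
  exact: ratderiv_scale_num (hY_gen_neq0 C 0) du.
rewrite [1 == 0]/= [X in _ ^ X](_ : _ = - delta%:Z); last first.
  by rewrite mulr2n; ring.
rewrite -exprnN -invfM other1.
exact: ratderiv_scale_den u0 (hY_gen_neq0 C 1) du.
Qed.

(** Multiplying the frame of degree (e1, e2) by dx_ij / dX_i' = 1 / X_i lowers
    its first degree by 1; multiplying it by dy_ij / dY_j' lowers its degree by
    that of Y_j'. *)
Lemma frame_divX (K : fieldType) (x x' y y' z b c : K) (u w : int) :
  x != 0 ->
  x ^ u * y ^ w * (b * ((1 * x - x' * 0) / x ^+ 2)
                   + c * ((0 * y - y' * 0) * z)) =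
    x ^ (u - 1) * y ^ w * b.
Proof.
move=> x0; rewrite expfzDr // -[x ^ (- 1)]/(x^-1).
by field.
Qed.

Lemma frame_divY (K : fieldType) (x x' y y' b c : K) (u v w : int) :
  x != 0 -> y != 0 ->
  x ^ u * y ^ w * (b * ((0 * x - x' * 0) / x ^+ 2)
                   + c * ((1 * y - y' * 0) * (x ^ v / y ^+ 2))) =
    x ^ (u + v) * y ^ (w - 1) * c.
Proof.
move=> x0 y0; rewrite !expfzDr // -[y ^ (- 1)]/(y^-1).
by field; rewrite x0 y0.
Qed.

Lemma pullback_componentX (C : fieldType) (delta : nat) (e1 e2 : int)
    (p : chart)
    (eta : 'rV[{mpoly C[2]}]_2) :
  (chart_frame C delta e1 e2 p *:
    pullback (chart_coord C delta p) eta) 0 (lshift 2 (other p.1)) =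
  frame delta (e1 - 1) e2 p (generic_point C) *
    ratsubst (chart_coord C delta p) (eta 0 0).
Proof.
rewrite !mxE sum_ord2 ratderiv_coord0 ratderiv_coord1; last first.
  by rewrite eq_lshift other_neq.
rewrite !eq_lrshift !eq_lshift eqxx other_neq !frameE [e1 - 1 - _]addrAC.
exact: frame_divX (hX_gen_neq0 C p.1).
Qed.

Lemma pullback_componentY (C : fieldType) (delta : nat) (e1 e2 : int)
    (p : chart)
    (eta : 'rV[{mpoly C[2]}]_2) :
  (chart_frame C delta e1 e2 p *:
    pullback (chart_coord C delta p) eta) 0 (rshift 2 (other p.2)) =
  frame delta (e1 - Yweight delta (other p.2)) (e2 - 1) p (generic_point C) *
    ratsubst (chart_coord C delta p) (eta 0 1).
Proof.
rewrite !mxE sum_ord2 ratderiv_coord0 ratderiv_coord1; last first.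
  by rewrite eq_rlshift.
rewrite !eq_rlshift !eq_rshift eqxx other_neq !frameE.
rewrite [LHS](frame_divY _ _ _ _ _ _ _ (hX_gen_neq0 C p.1) (hY_gen_neq0 C p.2)).
congr (_ ^ _ * _ * _).
by rewrite /Yweight; case: (ord2P p.2) => ->; rewrite ?other0 ?other1 /=; ring.
Qed.

Lemma mulf_div_sqr (K : fieldType) (a y : K) : y != 0 -> a * y / y ^+ 2 = a / y.
Proof. by move=> y0; field. Qed.

Lemma ratderiv_coord1_X0 (C : fieldType) (delta : nat) :
  ratderiv (lshift 2 0) (Defs.coord delta (0, 0) (generic_point C) 1) =
    delta%:R * (hX (generic_point C) 0 ^+ delta / hX (generic_point C) 0)
      * hY (generic_point C) 1 / hY (generic_point C) 0.
Proof.
rewrite /Defs.coord /= ratderiv_quot ?hY_gen_neq0 // ratderivM.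
rewrite ratderivXn ?hX_gen_neq0 // ratderiv_hX_gen !ratderiv_hY_gen.
rewrite eqxx !eq_lrshift !mulr0 addr0 subr0 mulr1.
exact: mulf_div_sqr (hY_gen_neq0 C 0).
Qed.

Lemma euler_X (K : fieldType) (d X0 X1 Y0 Y1 u b0 b1 : K) :
  X0 != 0 -> Y0 != 0 ->
  X0 * (b0 * ((0 * X0 - X1 * 1) / X0 ^+ 2) + b1 * (d * (u / X0) * Y1 / Y0))
  + X1 * (b0 * ((1 * X0 - X1 * 0) / X0 ^+ 2)
          + b1 * ((0 * Y0 - Y1 * 0) * (u / Y0 ^+ 2)))
  - d * Y1 * (b0 * ((0 * X0 - X1 * 0) / X0 ^+ 2)
          + b1 * ((1 * Y0 - Y1 * 0) * (u / Y0 ^+ 2))) = 0.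
Proof. by move=> x0 y0; field; rewrite x0 y0. Qed.

Lemma euler_Y (K : fieldType) (X0 X1 Y0 Y1 u b0 b1 : K) :
  Y0 * (b0 * ((0 * X0 - X1 * 0) / X0 ^+ 2)
          + b1 * ((0 * Y0 - Y1 * 1) * (u / Y0 ^+ 2)))
  + Y1 * (b0 * ((0 * X0 - X1 * 0) / X0 ^+ 2)
          + b1 * ((1 * Y0 - Y1 * 0) * (u / Y0 ^+ 2))) = 0.
Proof. by ring. Qed.

(** The Euler fields X_0 d/dX_0 + X_1 d/dX_1 - delta Y_1 d/dY_1 and Y_0 d/dY_0 +
    Y_1 d/dY_1 generate the torus action, under which the coordinates of the
    chart are invariant. *)
Lemma euler_identities (C : fieldType) (delta : nat)
    (eta : 'rV[{mpoly C[2]}]_2)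
    (W := pullback (chart_coord C delta (0, 0)) eta) :
  hX (generic_point C) 0 * W 0 (lshift 2 0)
    + hX (generic_point C) 1 * W 0 (lshift 2 1)
    - delta%:R * hY (generic_point C) 1 * W 0 (rshift 2 1) = 0
  /\ hY (generic_point C) 0 * W 0 (rshift 2 0)
       + hY (generic_point C) 1 * W 0 (rshift 2 1) = 0.
Proof.
rewrite /W !mxE !sum_ord2 !ratderiv_coord0 ratderiv_coord1_X0.
rewrite !ratderiv_coord1 ?eq_lshift ?eq_rlshift //.
rewrite ?eq_rshift ?eq_lshift ?eq_rlshift ?eq_lrshift ?other0 /= mul0rn addr0.
split; last exact: euler_Y.
exact: euler_X (hX_gen_neq0 C 0) (hY_gen_neq0 C 0).
Qed.

(** * Nowhere vanishing polynomials *)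

(** On the curve (t, t^N) with N larger than the degree, distinct monomials of
    [f] restrict to distinct powers of t. A polynomial in t without roots is
    constant, so only the monomial 1 occurs in [f]. *)
Lemma nowhere_zero_const (C : closedFieldType) (f : {mpoly C[2]}) :
  nowhere_zero f -> exists2 c : C, c != 0 & f = c%:MP.
Proof.
move=> nz; set N := msize f.
pose e (m : 'X_{1..2}) := (m 0%R + N * m 1%R)%N.
pose P : {poly C} := \sum_(m <- msupp f) f@_m *: 'X^(e m).
have bound m : m \in msupp f -> (m 0%R < N)%N.
  move=> /msize_mdeg_lt; apply: leq_ltn_trans.
  by rewrite mdegE (bigD1 0%R) ?leq_addr.
have coefP m : m \in msupp f -> P`_(e m) = f@_m.
  move=> mf; rewrite coef_sum (bigD1_seq m) ?msupp_uniq //=.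
  rewrite coefZ coefXn eqxx mulr1.
  rewrite big_seq_cond big1 ?addr0 // => m' /andP[m'f mm'].
  rewrite coefZ coefXn; case: eqP => [|_]; last by rewrite mulr0.
  rewrite /e => ee; case/eqP: mm'; apply/mnmP => k.
  have N0 : (0 < N)%N := leq_ltn_trans (leq0n _) (bound m mf).
  have := congr1 (modn^~ N) ee; have := congr1 (divn^~ N) ee.
  rewrite ![(_ + N * _)%N]addnC ![(N * _)%N]mulnC !modnMDl.
  rewrite !modn_small ?bound //.
  rewrite !divnMDl // !divn_small ?bound // !addn0 => e1 e0.
  by case: (ord2P k) => ->.
have horP t : P.[t] = f.@[fun k : 'I_2 => if k == 0 then t else t ^+ N].
  rewrite mevalE horner_sum; apply: eq_bigr => m _.
  rewrite hornerZ hornerXn big_ord_recl big_ord1 /= /e exprD exprM.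
  by congr (_ * (_ * _ ^+ m _)); exact: val_inj.
have sP : size P = 1%N.
  apply/eqP/negPn/negP => /closed_rootP[t]; rewrite /root horP.
  by rewrite (negbTE (nz _)).
have f0 : f != 0.
  by apply: contraTneq isT => f0; have := nz (fun=> 0); rewrite f0 meval0 eqxx.
have supp0 m : m \in msupp f -> m = 0%MM.
  move=> mf; apply: contraTeq (mf) => m0.
  rewrite -mcoeff_eq0 -coefP // nth_default ?sP // lt0n.
  apply: contra_neq m0 => em; apply/mnmP => k; rewrite mnm0E.
  have N0 : (0 < N)%N := leq_ltn_trans (leq0n _) (bound m mf).
  move/eqP: em; rewrite addn_eq0 muln_eq0.
  move=> /andP[/eqP z0 /orP[/eqP N00|/eqP z1]].
    by rewrite N00 in N0.
  by case: (ord2P k) => ->.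
have ef : f = (f@_0%MM)%:MP.
  apply/mpolyP => m; rewrite mcoeffC; have [->|m0] := eqVneq m 0%MM.
    by rewrite mulr1.
  rewrite mulr0; apply/eqP; rewrite mcoeff_eq0.
  by apply: contra_neqN m0 => /supp0.
exists f@_0%MM => //; apply: contraNneq f0 => c0.
by rewrite ef c0 mpolyC0.
Qed.

(** * The form attached to a foliation *)

Lemma map_tofrac_inj (R : idomainType) (m n : nat) :
  injective
    (map_mx (fun f : R => f%:F) : 'M[R]_(m, n) -> 'M[{fraction R}]_(m, n)).
Proof.
move=> A B /matrixP e; apply/matrixP => i j.
by have := e i j; rewrite !mxE => /eqP; rewrite tofrac_eq => /eqP.
Qed.

Lemma map_tofracZ (R : idomainType) (m n : nat) (c : R) (A : 'M[R]_(m, n)) :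
  map_mx (fun f : R => f%:F) (c *: A) = c%:F *: map_mx (fun f : R => f%:F) A.
Proof. by apply/matrixP => i j; rewrite !mxE tofracM. Qed.

Lemma pullbackZ (C : fieldType) (n m : nat) (z : 'I_n -> ratfun C m) (c : C)
    (eta : 'rV[{mpoly C[n]}]_n) :
  pullback z (c%:MP *: eta) = (c%:MP)%:F *: pullback z eta.
Proof.
apply/rowP => l; rewrite !mxE mulr_sumr; apply: eq_bigr => k _.
by rewrite !mxE ratsubstM ratsubstC -mulrA.
Qed.

Lemma contractE (C : fieldType) (w : {mpoly C[2]}) (v : 'rV[{mpoly C[2]}]_2) :
  contract w v = w *: contract 1 v.
Proof.
by apply/rowP => k; rewrite !mxE; case: ifP => _; rewrite !mul1r ?mulrN.
Qed.

Lemma contractZ (C : fieldType) (w a : {mpoly C[2]}) (v : 'rV[{mpoly C[2]}]_2) :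
  contract w (a *: v) = a *: contract w v.
Proof.
by apply/rowP => k; rewrite !mxE; case: ifP => _; rewrite ?mulrN mulrCA.
Qed.

Lemma contract_inj (C : fieldType) (w : {mpoly C[2]}) :
  w != 0 -> injective (contract w).
Proof.
move=> w0 v v' /rowP e; apply/rowP => k.
have := e 0; have := e 1; rewrite !mxE /=.
move=> /(mulfI w0) e0 /oppr_inj /(mulfI w0) e1.
by case: (ord2P k) => ->.
Qed.

Lemma chart_signC (C : fieldType) (p : chart) :
  chart_sign {mpoly C[2]} p = (chart_sign C p)%:MP.
Proof. by rewrite /chart_sign (rmorph_sign (@mpolyC 2 C)). Qed.

Lemma chart_sign_neq0 (K : fieldType) (p : chart) : chart_sign K p != 0.
Proof. by rewrite /chart_sign signr_eq0. Qed.

Lemma nowhere_zeroC (C : fieldType) (n : nat) (c : C) :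
  c != 0 -> nowhere_zero (c%:MP : {mpoly C[n]}).
Proof. by move=> c0 z; rewrite mevalC. Qed.

(** The pullback of [eta] to the total space, one chart at a time: the
    uniqueness arguments compare [Omega] with the forms on a single chart. *)
Definition total_form (C : fieldType) (delta : nat) (e1 e2 : int)
    (eta : chart -> 'rV[{mpoly C[2]}]_2)
    (Omega : 'rV[{mpoly C[2 + 2]}]_(2 + 2)) (p : chart) : Prop :=
  map_mx (fun f => f%:F) Omega =
    chart_frame C delta e1 e2 p *:
      pullback (chart_coord C delta p) (eta p).

Lemma total_form_exists (C : fieldType) (delta : nat) (e1 e2 : int)
    (eta : chart -> 'rV[{mpoly C[2]}]_2) :
  twisted_form delta e1 e2 eta ->
  exists Omega, forall p, total_form delta e1 e2 eta Omega p.
Proof.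
move=> tw.
pose W p := chart_frame C delta e1 e2 p *:
  pullback (chart_coord C delta p) (eta p).
have WE p : W p = W (0, 0) by exact: twisted_form_pullback tw.
have reg l : exists H : {mpoly C[2 + 2]}, W (0, 0) 0 l = H%:F.
  apply: regular_everywhere => p; rewrite -(WE p).
  exact: regular_on_pullback.
have [H HE] := fin_all_exists reg.
exists (\row_l H l) => p; rewrite /total_form -/(W p) WE.
by apply/rowP => l; rewrite !mxE -HE !mxE.
Qed.

(** The coefficient of dX_i' involves only the dx-coefficient of [eta], and that
    of dY_j' only the dy-coefficient, so each determines the other. *)
Lemma total_form_dehom (C : fieldType) (delta : nat) (e1 e2 : int)
    (eta : chart -> 'rV[{mpoly C[2]}]_2)
    (Omega : 'rV[{mpoly C[2 + 2]}]_(2 + 2)) (p : chart) :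
  total_form delta e1 e2 eta Omega p ->
  [/\ eta p = \row_k (if k == 0 then dehom p (Omega 0 (lshift 2 (other p.1)))
                      else dehom p (Omega 0 (rshift 2 (other p.2)))),
      bihomogeneous delta (e1 - 1) e2 (Omega 0 (lshift 2 (other p.1)))
    & bihomogeneous delta (e1 - Yweight delta (other p.2)) (e2 - 1)
        (Omega 0 (rshift 2 (other p.2)))].
Proof.
move=> tot.
have [|dX bX] := @section_of_chart C delta (e1 - 1) e2 p
    (Omega 0 (lshift 2 (other p.1))) (eta p 0 0).
  by rewrite -pullback_componentX -tot mxE.
have [|dY bY] := @section_of_chart C delta
    (e1 - Yweight delta (other p.2)) (e2 - 1) p
    (Omega 0 (rshift 2 (other p.2))) (eta p 0 1).
  by rewrite -pullback_componentY -tot mxE.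
split=> //; apply/rowP => k; rewrite mxE dX dY.
by case: (ord2P k) => ->.
Qed.

Lemma euler_factor_X (K : comPzRingType) (X0 X1 d Y1 f w0 w1 w3 : K) :
  X0 * (f * w0) + X1 * (f * w1) - d * Y1 * (f * w3) =
    f * (X0 * w0 + X1 * w1 - d * Y1 * w3).
Proof. by ring. Qed.

Lemma euler_factor_Y (K : comPzRingType) (Y0 Y1 f w2 w3 : K) :
  Y0 * (f * w2) + Y1 * (f * w3) = f * (Y0 * w2 + Y1 * w3).
Proof. by ring. Qed.

Lemma total_form_euler (C : fieldType) (delta : nat) (e1 e2 : int)
    (eta : chart -> 'rV[{mpoly C[2]}]_2)
    (Omega : 'rV[{mpoly C[2 + 2]}]_(2 + 2)) :
  total_form delta e1 e2 eta Omega (0, 0) ->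
  varX C 0 * Omega 0 (lshift 2 0) + varX C 1 * Omega 0 (lshift 2 1)
    - delta%:R * varY C 1 * Omega 0 (rshift 2 1) = 0
  /\ varY C 0 * Omega 0 (rshift 2 0) + varY C 1 * Omega 0 (rshift 2 1) = 0.
Proof.
move=> tot.
have OE l : (Omega 0 l)%:F = frame delta e1 e2 (0, 0) (generic_point C) *
    pullback (chart_coord C delta (0, 0)) (eta (0, 0)) 0 l.
  by have /rowP/(_ l) := tot; rewrite [LHS]mxE [RHS]mxE.
have [hx hy] := euler_identities delta (eta (0, 0)).
split; apply/eqP; rewrite -tofrac_eq0.
  rewrite tofracB tofracD !tofracM !OE (rmorph_nat (@FracField.tofrac _)).
  by rewrite euler_factor_X [X in _ * X]hx mulr0.
rewrite tofracD !tofracM !OE.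
by rewrite euler_factor_Y [X in _ * X]hy mulr0.
Qed.

(** The units allowed in the choice of local generators and of the area form are
    constants. *)
Lemma form_defines_contract (C : closedFieldType) (delta : nat) (l1 l2 : int)
    (F : foliation C delta l1 l2) (p : chart) (eta : 'rV[{mpoly C[2]}]_2) :
  form_defines F p eta ->
  exists2 c : C, c != 0 &
    eta = c%:MP *: contract (chart_sign _ p) (fol_section F p).
Proof.
move=> [v [w [[u /nowhere_zero_const[a a0 ->] sE] + ->]]].
move=> /nowhere_zero_const[b b0 ->].
exists (b / a / chart_sign C p).
  by rewrite !mulf_neq0 ?invr_eq0 ?chart_sign_neq0.
rewrite sE contractZ contractE [contract (chart_sign _ p) v]contractE.
rewrite chart_signC.
rewrite !scalerA -!mpolyCM; congr (_%:MP *: _).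
by field; rewrite a0 chart_sign_neq0.
Qed.

Lemma form_defines_signZ (C : fieldType) (delta : nat) (l1 l2 : int)
    (F : foliation C delta l1 l2) (p : chart) (c : C) :
  c != 0 ->
  form_defines F p (c%:MP *: contract (chart_sign _ p) (fol_section F p)).
Proof.
move=> c0; exists (fol_section F p), (c%:MP * chart_sign _ p); split.
- exists 1; rewrite ?scale1r // -mpolyC1.
  by apply: nowhere_zeroC; exact: oner_neq0.
- rewrite chart_signC -mpolyCM; apply: nowhere_zeroC.
  by rewrite mulf_neq0 ?chart_sign_neq0.
by rewrite contractE [RHS]contractE scalerA.
Qed.

Lemma twisted_formZ (C : fieldType) (delta : nat) (e1 e2 : int) (c : C)
    (eta : chart -> 'rV[{mpoly C[2]}]_2) :
  twisted_form delta e1 e2 eta ->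
  twisted_form delta e1 e2 (fun p => c%:MP *: eta p).
Proof.
move=> tw p q; rewrite pullbackZ map_tofracZ scalerA mulrC -scalerA tw.
by rewrite !scalerA mulrC.
Qed.

Lemma total_formZ (C : fieldType) (delta : nat) (e1 e2 : int) (c : C)
    (eta eta' : chart -> 'rV[{mpoly C[2]}]_2)
    (Omega : 'rV[{mpoly C[2 + 2]}]_(2 + 2)) (p : chart) :
  eta' p = c%:MP *: eta p ->
  total_form delta e1 e2 eta Omega p ->
  total_form delta e1 e2 eta' (c%:MP *: Omega) p.
Proof.
move=> e tot; rewrite /total_form e pullbackZ map_tofracZ tot.
by rewrite !scalerA mulrC.
Qed.

Lemma total_form_inj (C : fieldType) (delta : nat) (e1 e2 : int)
    (eta eta' : chart -> 'rV[{mpoly C[2]}]_2)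
    (Omega Omega' : 'rV[{mpoly C[2 + 2]}]_(2 + 2)) (p : chart) :
  eta p = eta' p ->
  total_form delta e1 e2 eta Omega p -> total_form delta e1 e2 eta' Omega' p ->
  Omega = Omega'.
Proof. by move=> e tot tot'; apply: map_tofrac_inj; rewrite tot tot' e. Qed.

Lemma total_form_neq0 (C : fieldType) (delta : nat) (e1 e2 : int)
    (eta : chart -> 'rV[{mpoly C[2]}]_2)
    (Omega : 'rV[{mpoly C[2 + 2]}]_(2 + 2)) (p : chart) :
  total_form delta e1 e2 eta Omega p -> eta p != 0 -> Omega != 0.
Proof.
move=> tot; apply: contraNneq => O0; have [-> _ _] := total_form_dehom tot.
apply/eqP/rowP => k; rewrite O0 !mxE; case: ifP => _; exact: raddf0.
Qed.

Definition signed_contraction (C : fieldType) (delta : nat) (l1 l2 : int)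
    (F : foliation C delta l1 l2) (p : chart) : 'rV[{mpoly C[2]}]_2 :=
  contract (chart_sign _ p) (fol_section F p).

Lemma annihilator_signed_contraction (C : fieldType) (delta : nat) (l1 l2 : int)
    (F : foliation C delta l1 l2) (c : C) :
  c != 0 -> annihilator F (fun p => c%:MP *: signed_contraction F p).
Proof.
move=> c0; split; last by move=> p; exact: form_defines_signZ.
exact: twisted_formZ (contract_twisted_form (fol_sectionP F)).
Qed.

Lemma foliation_total_form (C : fieldType) (delta : nat) (l1 l2 : int)
    (F : foliation C delta l1 l2) :
  exists2 Omega : 'rV[{mpoly C[2 + 2]}]_(2 + 2), Omega != 0 &
    forall p, total_form delta (- l1 + 2 - delta%:Z) (- l2 + 2)
                (signed_contraction F) Omega p.
Proof.
have [Omega tot] := total_form_exists (contract_twisted_form (fol_sectionP F)).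
exists Omega => //; have [p sp0] := fol_section_neq0 F.
apply: (total_form_neq0 (tot p)); apply: contraNneq sp0 => e0.
apply/eqP; apply: (@contract_inj C (chart_sign _ p)).
  by rewrite chart_signC mpolyC_eq0 chart_sign_neq0.
rewrite e0; apply/rowP => k; rewrite !mxE mulr0 oppr0.
by case: ifP.
Qed.

(** The coefficients of dX_i and of dY_j are visible on the charts with the
    other indices. *)
Lemma total_form_bidegrees (C : fieldType) (delta : nat) (e1 e2 : int)
    (eta : chart -> 'rV[{mpoly C[2]}]_2)
    (Omega : 'rV[{mpoly C[2 + 2]}]_(2 + 2)) :
  (forall p, total_form delta e1 e2 eta Omega p) ->
  (forall i, bihomogeneous delta (e1 - 1) e2 (Omega 0 (lshift 2 i)))
  /\ (forall j, bihomogeneous delta (e1 - Yweight delta j) (e2 - 1)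
                (Omega 0 (rshift 2 j))).
Proof.
have otherK i : other (other i) = i by exact: rev_ordK.
move=> tot; split=> i;
  have [_ bX bY] := total_form_dehom (tot (other i, other i)).
  by rewrite otherK in bX.
by rewrite otherK in bY.
Qed.

Lemma determines_scale (C : fieldType) (delta : nat) (l1 l2 : int)
    (F : foliation C delta l1 l2) (Omega : 'rV[{mpoly C[2 + 2]}]_(2 + 2))
    (c : C) :
  (forall p, total_form delta (- l1 + 2 - delta%:Z) (- l2 + 2)
               (signed_contraction F) Omega p) ->
  c != 0 -> determines (c%:MP *: Omega) F.
Proof.
move=> tot c0; pose eta' q := c%:MP *: signed_contraction F q.
exists eta'; first exact: annihilator_signed_contraction.
by move=> p; exact: (@total_formZ _ _ _ _ c _ eta' _ p erefl (tot p)).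
Qed.

Lemma determines_unique (C : closedFieldType) (delta : nat) (l1 l2 : int)
    (F : foliation C delta l1 l2)
    (Omega Omega' : 'rV[{mpoly C[2 + 2]}]_(2 + 2)) :
  (forall p, total_form delta (- l1 + 2 - delta%:Z) (- l2 + 2)
               (signed_contraction F) Omega p) ->
  determines Omega' F -> exists2 c : C, c != 0 & Omega' = c%:MP *: Omega.
Proof.
move=> tot [eta [_ defs] tot'].
have [c c0 e] := form_defines_contract (defs (0, 0)); exists c => //.
pose eta' q := c%:MP *: signed_contraction F q.
apply: (@total_form_inj _ _ _ _ eta eta' _ _ (0, 0) e (tot' (0, 0))).
exact: total_formZ (tot (0, 0)).
Qed.

(** [Omega] recovers the contractions of the section of [F] on the charts, and
    those of the section of [G] up to constants; every one of these constants is
    the ratio of [Omega] to the form attached to [G], hence they are equal. *)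
Lemma determines_same_foliation (C : closedFieldType) (delta : nat)
    (l1 l2 : int) (F G : foliation C delta l1 l2)
    (Omega : 'rV[{mpoly C[2 + 2]}]_(2 + 2)) :
  (forall p, total_form delta (- l1 + 2 - delta%:Z) (- l2 + 2)
               (signed_contraction F) Omega p) ->
  determines Omega G -> same_foliation F G.
Proof.
move=> tot [eta [_ defs] tot'].
have [OmegaG OG0 totG] := foliation_total_form G.
have [k k0 kE] := form_defines_contract (defs (0, 0)).
have eE p : eta p = signed_contraction F p.
  have [-> _ _] := total_form_dehom (tot' p).
  by have [-> _ _] := total_form_dehom (tot p).
have OE p c :
    eta p = c%:MP *: signed_contraction G p -> Omega = c%:MP *: OmegaG.
  move=> e.
  exact: total_form_inj (erefl (eta p)) (tot' p) (total_formZ e (totG p)).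
exists k^-1; first by rewrite invr_eq0.
move=> p; have [c c0 cE] := form_defines_contract (defs p).
have ck : c = k.
  have /eqP := OE _ _ cE; rewrite (OE _ _ kE) -subr_eq0 -scalerBl scalemx_eq0.
  by rewrite (negbTE OG0) orbF -mpolyCB mpolyC_eq0 subr_eq0 => /eqP.
apply: (@contract_inj C (chart_sign _ p)).
  by rewrite chart_signC mpolyC_eq0 chart_sign_neq0.
rewrite contractZ -[contract _ (fol_section F p)]/(signed_contraction F p).
by rewrite -eE cE ck scalerA -mpolyCM mulVf // mpolyC1 scale1r.
Qed.

Lemma form_defines_dehom (C : fieldType) (delta : nat) (l1 l2 : int)
    (F : foliation C delta l1 l2) (Omega : 'rV[{mpoly C[2 + 2]}]_(2 + 2))
    (i j : 'I_2) :
  total_form delta (- l1 + 2 - delta%:Z) (- l2 + 2)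
    (signed_contraction F) Omega (i, j) ->
  form_defines F (i, j)
    (\row_k (if k == 0 then dehom (i, j) (lsubmx Omega 0 (other i))
             else dehom (i, j) (rsubmx Omega 0 (other j)))).
Proof.
move=> tot; have := form_defines_signZ F (i, j) (oner_neq0 C).
rewrite mpolyC1 scale1r -/(signed_contraction F (i, j)).
have [-> _ _] := total_form_dehom tot.
by congr form_defines; apply/rowP => k; rewrite !mxE.
Qed.

Theorem proposition3p2 (R : realType) (delta : nat) (d1 d2 : int)
    (F : foliation R[i] delta (- d1) (- d2)) :
  exists A B : 'rV[{mpoly R[i][2 + 2]}]_2,
    let Omega := row_mx A B in
    [/\ [/\ bihomogeneous delta (d1 - delta%:Z + 1) (d2 + 2) (A 0 0),
            bihomogeneous delta (d1 - delta%:Z + 1) (d2 + 2) (A 0 1),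
            bihomogeneous delta (d1 - delta%:Z + 2) (d2 + 1) (B 0 0)
          & bihomogeneous delta (d1 + 2) (d2 + 1) (B 0 1)],
        [/\ Omega != 0,
            varX R[i] 0 * A 0 0 + varX R[i] 1 * A 0 1
              - delta%:R * varY R[i] 1 * B 0 1 = 0
          & varY R[i] 0 * B 0 0 + varY R[i] 1 * B 0 1 = 0],
        determines Omega F,
        (forall Omega' : 'rV[{mpoly R[i][2 + 2]}]_(2 + 2),
           determines Omega' F <->
           exists2 c : R[i], c != 0 & Omega' = c%:MP *: Omega)
        /\ (forall G : foliation R[i] delta (- d1) (- d2),
              determines Omega G -> same_foliation F G)
      & forall i j : 'I_2,
          form_defines F (i, j)
            (\row_k (if k == 0 then dehom (i, j) (A 0 (other i))
                     else dehom (i, j) (B 0 (other j))))].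
Proof.
have [Omega O0 tot] := foliation_total_form F.
have [bX bY] := total_form_bidegrees tot.
have [euX euY] := total_form_euler (tot (0, 0)).
exists (lsubmx Omega), (rsubmx Omega); rewrite hsubmxK !mxE /=; split=> //.
- have conv e1 e2 e1' e2' (H : {mpoly R[i][2 + 2]}) : e1 = e1' -> e2 = e2' ->
      bihomogeneous delta e1 e2 H -> bihomogeneous delta e1' e2' H.
    by move=> -> ->.
  split; [apply: conv (bX 0)|apply: conv (bX 1)|apply: conv (bY 0)|
    apply: conv (bY 1)]; rewrite /Yweight /=; ring.
- rewrite -[Omega]scale1r -mpolyC1.
  exact: determines_scale tot (oner_neq0 R[i]).
- split=> [Omega'|G]; last exact: determines_same_foliation.
  split=> [|[c c0 ->]]; first exact: determines_unique.
  exact: determines_scale.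
by move=> i j; exact: form_defines_dehom (tot (i, j)).
Qed.
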